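(* For every simple $\mathfrak g$, every total order on $\widehat I$ for which connectivity holds, and every increasing chain $\mathrm{ch}(\alpha)\in\mathcal I$, the periodicity $c_\alpha$ is bounded above by the number given below according to the type of the untwisted affine root system: $A_n^{(1)},D_n^{(1)}$: $1$; $B_n^{(1)},C_n^{(1)}$: $2$; $E_6^{(1)}$: $2$; $E_7^{(1)}$: $2$; $E_8^{(1)}$: $3$; $F_4^{(1)}$: $2$; $G_2^{(1)}$: $3$.
   Context: Affine setup. Let $\mathfrak g$ be a simple finite-dimensional complex Lie algebra with Cartan subalgebra $\mathfrak h$, root system $\Delta=\Delta^+\sqcup\Delta^-$, simple roots $\{\alpha_i\}_{i\in I}$, highest root $\theta$, root lattice $Q$. Put $\widehat I=I\sqcup\{0\}$, $\widehat Q=Q\times\mathbb Z$, identify $\alpha_i$ with $(\alpha_i,0)$ for $i\in I$, and set $\alpha_0=(-\theta,1)$, $\delta=(0,1)$. For $\beta=\sum_{i\in\widehat I}n_i\alpha_i$ put $|\beta|=\sum n_i$. Real positive affine roots: $\widehat\Delta^{+,\mathrm{re}}=(\Delta^+\times\mathbb Z_{\ge0})\sqcup(\Delta^-\times\mathbb Z_{>0})$; imaginary ones: $k\delta$, $k\ge1$. Let $\widehat{\mathfrak n}^+$ be the Lie algebra spanned by $\mathfrak g_\alpha t^k$ ($(\alpha,k)\in\widehat\Delta^{+,\mathrm{re}}$) and $\mathfrak h t^k$ ($k\ge1$), with $[xt^n,yt^m]=[x,y]t^{n+m}$; it is generated by $e_i=e_{\alpha_i}t^0$ ($i\in I$) and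 $e_0=e_{-\theta}t^1$. Words. Fix a total order on $\widehat I$; order words in $\widehat I$ lexicographically (a proper prefix is smaller). $|w|$ is the length; $\deg[i_1\ldots i_k]=\sum\alpha_{i_r}$. A Lyndon word is a nonempty word smaller than all its proper nonempty suffixes. For a Lyndon word $\ell$ with $|\ell|>1$ the costandard factorization is $\ell=\ell^l\ell^r$ with $\ell^r$ the longest proper Lyndon suffix. Bracketing: $\mathsf b[i]=e_i$, $\mathsf b[\ell]=[\mathsf b[\ell^l],\mathsf b[\ell^r]]$. A Lyndon word $\ell$ is standard Lyndon if $\mathsf b[\ell]\in\widehat{\mathfrak n}^+$ is not a linear combination of $\mathsf b[v]$ over Lyndon $v$ with $|v|<|\ell|$, or $|v|=|\ell|$ and $v>\ell$. Each $\alpha\in\widehat\Delta^{+,\mathrm{re}}$ is the degree of a unique standard Lyndon word $\mathrm{SL}(\alpha)$, and each $k\delta$ is the degree of exactly $|I|$ of them, $\mathrm{SL}_1(k\delta)>\dots>\mathrm{SL}_{|I|}(k\delta)$. On $\widehat\Delta^{+,\mathrm{re}}$ put $\alpha<\beta$ iff $\mathrm{SL}(\alpha)<\mathrm{SL}(\beta)$. Flags. Let $\mathcal S^1_i=\mathrm{span}\{\mathsf b[\mathrm{SL}_1(\delta)],\dots,\mathsf b[\mathrm{SL}_i(\delta)]\}\subset\mathfrak ht$. For $\alpha$ real affine with finite part $\bar\alpha\in\Delta$ (or $\alpha=\bar\alpha\in\Delta$) let $h_\alpha\in\mathfrak h$ be the element associated with $\bar\alpha$ (spanning $[\mathfrak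 g_{\bar\alpha},\mathfrak g_{-\bar\alpha}]$), and set $m_1(\alpha)=(\delta,i)$ if $h_\alpha t\in\mathcal S^1_i\setminus\mathcal S^1_{i-1}$. Chains. For $\alpha\in\widehat\Delta^{+,\mathrm{re}}$ let $\alpha'$ be the element of $\alpha+\mathbb Z\delta$ in $\widehat\Delta^{+,\mathrm{re}}$ with $|\alpha'|<|\delta|$, and $\mathrm{ch}(\alpha)=(\alpha',\alpha'+\delta,\alpha'+2\delta,\dots)$. It is known that each chain is strictly monotone for $<$; $\mathcal I$ is the set of increasing chains. Let $\mathrm{Pr}(\mathrm{ch}(\alpha))\in\Delta$ be the finite part of $\alpha$. Then $\Delta^+_p=\mathrm{Pr}(\mathcal I)$ is a positive system of $\Delta$. Its simple roots are denoted $\beta_1,\dots,\beta_{|I|}$, numbered so that $m_1(\beta_i)=(\delta,i)$. Connectivity (a conjecture of the paper): for every $1\le i\le|I|$ the root subsystem $\Delta_i=\{\alpha\in\Delta:h_\alpha t\in\mathcal S^1_i\}$ is irreducible; equivalently, the Dynkin subdiagram on $\beta_1,\dots,\beta_i$ is connected. Periodicity of increasing chains. For $\mathrm{ch}(\alpha)\in\mathcal I$ with $\mathrm{Pr}(\mathrm{ch}(\alpha))=c_1\beta_1+\dots+c_i\beta_i$, $c_i\ne0$ (all $c_j\ge0$), set $c_\alpha=c_i$; it is called the periodicity of $\mathrm{ch}(\alpha)$. *)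

(* Defs.v *)
From HB Require Import structures.
From mathcomp Require Import all_boot all_order all_algebra.
From mathcomp Require Import finmap boolp classical_sets cardinality reals.
From mathcomp Require Import complex.

Set Implicit Arguments.
Unset Strict Implicit.
Unset Printing Implicit Defensive.

Import Order.TTheory GRing.Theory Num.Theory.

Local Open Scope classical_set_scope.
Local Open Scope ring_scope.

HB.mixin Record isLieAlgebra (K : fieldType) (g : Type) of Vector K g := {
  lie : g -> g -> g;
  lie_linearl : forall (c : K) (x y z : g),
    lie (c *: x + y) z = c *: lie x z + lie y z;
  lie_linearr : forall (c : K) (x y z : g),
    lie z (c *: x + y) = c *: lie z x + lie z y;
  liexx : forall x : g, lie x x = 0;
  lie_jacobi : forall x y z : g,
    lie x (lie y z) + lie y (lie z x) + lie z (lie x y) = 0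
}.

#[short(type="finLieAlgType")]
HB.structure Definition FinLieAlgebra (K : fieldType) :=
  {g of Vector K g & isLieAlgebra K g}.

Definition lie_ideal (K : fieldType) (g : finLieAlgType K) (U : {vspace g}) :=
  forall x y : g, y \in U -> lie x y \in U.

Definition simple_lie (K : fieldType) (g : finLieAlgType K) :=
  (exists x y : g, lie x y <> 0) /\
  (forall U : {vspace g}, lie_ideal U -> U = 0%VS \/ U = fullv).

(* Cartan subalgebras in the form usual for complex semisimple Lie algebras:
   commutative, equal to its own centralizer, and acting on g by
   (ad-)diagonalizable endomorphisms. *)
Definition ad_diagonalizable (K : fieldType) (g : finLieAlgType K) (u : g) :=
  exists2 X : seq g, basis_of fullv X
                   & forall x, x \in X -> exists a : K, lie u x = a *: x.

Definition cartan_subalgebra (K : fieldType) (g : finLieAlgType K)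
    (h : {vspace g}) :=
  [/\ forall u v, u \in h -> v \in h -> lie u v = 0,
      forall x, (forall u, u \in h -> lie u x = 0) -> x \in h
    & forall u, u \in h -> ad_diagonalizable u].

Definition dual (K : fieldType) (g : finLieAlgType K) (h : {vspace g}) :=
  'Hom(subvs_of h, K^o).

Section Roots.
Context (K : fieldType) (g : finLieAlgType K) (h : {vspace g}).

Definition root_space (a : dual h) : set g :=
  [set x | forall u : subvs_of h, lie (vsval u) x = (a u : K) *: x].

Definition is_root : set (dual h) :=
  [set a | a <> 0 /\ exists2 x, root_space a x & x <> 0].

(* The element h_a of [g_a, g_-a], normalized by a(h_a) = 2. *)
Definition coroot (a : dual h) : subvs_of h :=
  xget 0 [set u | a u = 2%:R /\
    exists x y, [/\ root_space a x, root_space (- a) y & vsval u = lie x y]].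

Definition ncone (J : finType) (B : J -> dual h) : set (dual h) :=
  [set a | exists c : J -> nat, a = \sum_j B j *+ c j].

Definition root_base (J : finType) (B : J -> dual h) :=
  [/\ forall j, is_root (B j),
      free [seq B j | j : J]
    & forall a, is_root a -> ncone B a \/ ncone B (- a)].

Definition pos_roots (J : finType) (B : J -> dual h) : set (dual h) :=
  is_root `&` ncone B.

Definition irreducible_roots (D : set (dual h)) :=
  D !=set0 /\
  forall A B : set (dual h), D = A `|` B ->
    (forall a b, A a -> B b -> a (coroot b) = 0) -> A = set0 \/ B = set0.

End Roots.

Inductive cartan_type : Type :=
  | TypeA of nat | TypeB of nat | TypeC of nat | TypeD of nat
  | TypeE6 | TypeE7 | TypeE8 | TypeF4 | TypeG2.

Definition cartan_type_ok (T : cartan_type) : bool :=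
  match T with
  | TypeA n => 1 <= n
  | TypeB n => 2 <= n
  | TypeC n => 2 <= n
  | TypeD n => 4 <= n
  | _ => true
  end%N.

Definition type_rank (T : cartan_type) : nat :=
  match T with
  | TypeA n | TypeB n | TypeC n | TypeD n => n
  | TypeE6 => 6 | TypeE7 => 7 | TypeE8 => 8 | TypeF4 => 4 | TypeG2 => 2
  end%N.

Definition laced (adj : rel nat) (i j : nat) : int :=
  if i == j then 2 else if adj i j || adj j i then -1 else 0.

Definition path_adj : rel nat := fun i j => j == i.+1.

Definition D_adj (n : nat) : rel nat :=
  fun i j => if j == n.-1 then i == (n - 3)%N else j == i.+1.

Definition E_adj : rel nat :=
  fun i j => (i, j) \in [:: (0, 2); (1, 3); (2, 3); (3, 4); (4, 5); (5, 6);
                            (6, 7)]%N.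

(* Bourbaki's labelling, shifted to start at 0; the (i, j) entry is
   the value of the j-th simple root on the i-th simple coroot. *)
Definition cartan_entry (T : cartan_type) (i j : nat) : int :=
  match T with
  | TypeA _ => laced path_adj i j
  | TypeB n => if (i == n.-1) && (j == n.-2) then -2 else laced path_adj i j
  | TypeC n => if (i == n.-2) && (j == n.-1) then -2 else laced path_adj i j
  | TypeD n => laced (D_adj n) i j
  | TypeE6 | TypeE7 | TypeE8 => laced E_adj i j
  | TypeF4 => if (i, j) == (2, 1)%N then -2 else laced path_adj i j
  | TypeG2 => if (i, j) == (0, 1)%N then -3 else laced path_adj i j
  end.

Definition periodicity_bound (T : cartan_type) : nat :=
  match T with
  | TypeA _ | TypeD _ => 1
  | TypeB _ | TypeC _ => 2
  | TypeE6 | TypeE7 => 2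
  | TypeE8 => 3
  | TypeF4 => 2
  | TypeG2 => 3
  end%N.

Definition total_order (A : Type) (le : rel A) :=
  [/\ reflexive le, antisymmetric le, transitive le & total le].

Section Words.
Context (A : eqType) (le : rel A).

Fixpoint lexlt (u v : seq A) : bool :=
  match u, v with
  | _, [::] => false
  | [::], _ :: _ => true
  | x :: u', y :: v' => if x == y then lexlt u' v' else le x y
  end.

Definition lyndon (w : seq A) : bool :=
  (w != [::]) && all (fun k => lexlt w (drop k w)) (iota 1 (size w).-1).

(* Length of the left factor in the costandard factorization: the least
   k >= 1 such that [drop k w] is Lyndon. *)
Definition costd (w : seq A) : nat :=
  (find (fun k => lyndon (drop k w)) (iota 1 (size w).-1)).+1.

End Words.

(* [None] is the affine node 0 of the extended index set [option I]. *)
Record affine_datum (K : fieldType) (g : finLieAlgType K) (I : finType) := {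
  cartan : {vspace g};
  cartanP : cartan_subalgebra cartan;
  alpha : I -> dual cartan;
  alphaP : root_base alpha;
  theta : dual cartan;
  theta_root : is_root theta;
  theta_highest : forall a, is_root a -> ncone alpha (theta - a);
  egen : option I -> g;
  egenP : forall i, egen i <> 0 /\
    root_space (if i is Some j then alpha j else - theta) (egen i)
}.

Section Affine.
Context (K : fieldType) (g : finLieAlgType K) (I : finType).
Context (X : affine_datum g I) (le : rel (option I)).

Let h : {vspace g} := cartan X.

(* Affine weights: finite part and multiple of delta.  The lattice
   Q * int sits inside this group. *)
Definition aweight : Type := (dual h * int)%type.

Definition aroot (i : option I) : aweight :=
  if i is Some j then (alpha X j, 0) else (- theta X, 1).

Definition delta : aweight := (0, 1).

Definition height (b : aweight) : int :=
  xget 0 [set n | exists2 c : option I -> int,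
                    b = \sum_i aroot i *~ c i & n = \sum_i c i].

Definition real_pos : set aweight :=
  [set b | (pos_roots (alpha X) b.1 /\ 0 <= b.2) \/
           (pos_roots (alpha X) (- b.1) /\ 0 < b.2)].

(* The positive part of the loop algebra lies in g[t], hence in g[[t]], whose
   elements are written as their coefficient sequences [nat -> g]. *)
Definition loop_lie (x y : nat -> g) : nat -> g :=
  fun n => \sum_(i < n.+1) lie (x i) (y (n - i)%N).

Definition monom (x : g) (k : nat) : nat -> g :=
  fun n => if n == k then x else 0.

Definition affine_gen (i : option I) : nat -> g :=
  monom (egen X i) (if i is Some _ then 0%N else 1%N).

(* [n] is fuel; [size w] is enough. *)
Fixpoint bracketing_rec (n : nat) (w : seq (option I)) : nat -> g :=
  match n, w with
  | _.+1, [:: i] => affine_gen i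
  | n'.+1, _ => loop_lie (bracketing_rec n' (take (costd le w) w))
                         (bracketing_rec n' (drop (costd le w) w))
  | 0%N, _ => fun=> 0
  end.

Definition bracketing (w : seq (option I)) : nat -> g :=
  bracketing_rec (size w) w.

Definition degree (w : seq (option I)) : aweight := \sum_(i <- w) aroot i.

Definition lin_comb (s : seq (seq (option I))) (x : nat -> g) :=
  exists c : seq (option I) -> K,
    forall n, x n = \sum_(v <- s) c v *: bracketing v n.

Definition standard_lyndon (l : seq (option I)) :=
  lyndon le l /\
  ~ exists s : seq (seq (option I)),
      all (fun v => lyndon le v &&
             ((size v < size l)%N || ((size v == size l) && lexlt le l v))) s
      /\ lin_comb s (bracketing l).

Definition SL (a : aweight) : seq (option I) :=
  xget [::] [set w | standard_lyndon w /\ degree w = a].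

Definition root_lt (a b : aweight) : bool := lexlt le (SL a) (SL b).

(* All standard Lyndon words of degree delta, in decreasing order; SL_i(delta)
   is the entry of index i - 1. *)
Definition SL_delta : seq (seq (option I)) :=
  sort (fun u v => ~~ lexlt le u v)
       (fset_set [set w | standard_lyndon w /\ degree w = delta]).

(* h_a t lies in the span of the first i bracketings b[SL_j(delta)] *)
Definition in_flag (i : nat) (a : dual h) :=
  lin_comb (take i SL_delta) (monom (vsval (coroot a)) 1).

(* m_1(a) = (delta, i), for i >= 1 *)
Definition m1_is (a : dual h) (i : nat) := in_flag i a /\ ~ in_flag i.-1 a.

Definition connectivity :=
  forall i : nat, (1 <= i <= #|I|)%N ->
    irreducible_roots [set a : dual h | is_root a /\ in_flag i a].

Definition chain_start (a : aweight) : aweight :=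
  xget 0 [set b | [/\ real_pos b, exists m : int, b = a + delta *~ m
                    & height b < height delta]].

Definition chain (a : aweight) : nat -> aweight :=
  fun k => chain_start a + delta *+ k.

Definition increasing_chains : set (nat -> aweight) :=
  [set c | (exists2 a, real_pos a & c = chain a) /\
           forall k, root_lt (c k) (c k.+1)].

(* the finite part is constant along a chain *)
Definition Pr (c : nat -> aweight) : dual h := (c 0%N).1.

Definition Delta_p : set (dual h) := Pr @` increasing_chains.

(* [beta] lists the simple roots of the positive system Delta_p, numbered
   along the flag; the index j : 'I_#|I| stands for the number j + 1. *)
Definition Delta_p_simple_roots (beta : 'I_#|I| -> dual h) :=
  [/\ root_base beta,
      Delta_p = pos_roots beta
    & forall j, m1_is (beta j) j.+1].

Definition is_periodicity (beta : 'I_#|I| -> dual h) (c : nat -> aweight)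
    (p : nat) :=
  exists (n : 'I_#|I| -> nat) (i : 'I_#|I|),
    [/\ Pr c = \sum_j beta j *+ n j,
        n i <> 0%N,
        forall j : 'I_#|I|, (i < j)%N -> n j = 0%N
      & p = n i].

Definition has_cartan_type (T : cartan_type) :=
  exists2 s : I -> 'I_(type_rank T), bijective s
    & forall i j, alpha X j (coroot (alpha X i))
                  = (cartan_entry T (s i) (s j))%:~R.

End Affine.

(* Main.v *)
(* The connectivity hypothesis says that removing the last simple root from
   {beta_1, ..., beta_i} leaves a connected diagram, so that beta_i is a leaf of the
   diagram on the support of any root whose top node is beta_i.  All bases of Delta
   are conjugate under reflections, hence the beta_j have the Dynkin type of g, and
   it remains to bound the coefficient of a leaf of the support in a positive root.
   Positive roots arise from simple ones by reflections increasing the height: in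
   types A, B, C, D one follows the coordinates in the standard basis eps_k along
   these reflections, in the exceptional types the positive roots are enumerated.
   The root system axioms for (g, h) come from the Killing form, which is
   nondegenerate because the simple coroots are genuine: kappa(h_a, h_a) is then a
   sum of squares of integers, not all zero, and the radical is an ideal. *)
From HB Require Import structures.
Require Import Defs.
From mathcomp Require Import all_boot all_order all_algebra.
From mathcomp Require Import boolp classical_sets reals complex.
From mathcomp Require Import finmap.
From mathcomp Require Import zify ring lra.

Set Implicit Arguments.
Unset Strict Implicit.
Unset Printing Implicit Defensive.

Import Order.TTheory GRing.Theory Num.Theory passmx.

Local Open Scope classical_set_scope.
Local Open Scope ring_scope.

(** * Weights and strings *)

(** The obstacle on the Lie algebra side is that [coroot] is chosen by [xget] and could be its
    default 0. A diagonal Cartan entry 2 excludes this for one simple root, and that root alone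
    makes the Killing form nondegenerate; nondegeneracy then excludes the default for every root.
    Origin of the bounds: in types A, B, C and G2 the values 1, 2, 2, 3 are the largest coefficients
    of positive roots. In types D, E6, E7, E8, F4 these reach 2, 3, 4, 6, 4, and a coefficient above
    the bound occurs only when the support meets both sides of a cut of the diagram at the node in
    question. Such cuts are what [uncut] forbids. Connectivity is therefore used one flag step below
    the top node: irreducibility there leaves no way to split the nodes under it into orthogonal
    parts. *)

Section Codiagonalization.
Context (K : fieldType) (V : vectType K).

Let e := vbasis {:V}.
Let eb : basis_of {:V} e := vbasisP _.
Let M (f : 'End(V)) := mxof e e f.

(** Simultaneous diagonalization for matrices, [codiagonalizableP], is carried to endomorphisms and
    back by coordinates in the basis [e]. *)
Lemma codiagonalizable_basis (fs : seq 'End(V)) :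
  (forall f1 f2, f1 \in fs -> f2 \in fs -> forall x, f1 (f2 x) = f2 (f1 x)) ->
  (forall f, f \in fs -> exists2 X : seq V, basis_of fullv X &
     forall x, x \in X -> exists a, f x = a *: x) ->
  exists2 X : seq V, basis_of fullv X &
    forall x, x \in X -> forall f, f \in fs -> exists a, f x = a *: x.
Proof.
move=> fC fD.
have [|P Pu /allP/= PM] := (codiagonalizableP (map M fs)).1.
  split.
    move=> _ _ /mapP[f1 f1s ->] /mapP[f2 f2s ->].
    rewrite /comm_mx -!(mxof_comp _ _ eb); congr mxof; apply/lfunP => x.
    by rewrite !comp_lfunE fC.
  move=> _ /mapP[f fs_f ->]; have [X Xb Xf] := fD f fs_f.
  apply/codiagonalizable1/codiagonalizablePfull.
  (* The rows of [Q] are the coordinates of an eigenbasis of [f], so conjugation by [Q] diagonalizes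
     the matrix of [f]. *)
  pose Q := \matrix_(k < size X) rVof e (tnth (in_tuple X) k).
  have Qfull : row_full Q.
    rewrite -sub1mx; apply/row_subP => i.
    rewrite -[row i 1%:M](vecofK eb).
    rewrite [vecof e _](coord_basis (X := in_tuple X) Xb (memvf _)) linear_sum /=.
    apply: summx_sub => k _; rewrite linearZ /=; apply: scalemx_sub.
    by rewrite (eq_row_sub k) // rowK (tnth_nth 0).
  exists (size X), Q => //; rewrite /= andbT.
  have/fin_all_exists [d dP] (k : 'I_(size X)) : exists a,
      f (tnth (in_tuple X) k) = a *: tnth (in_tuple X) k.
    by apply: Xf; rewrite mem_tnth.
  apply/diagonalizable_forPex; exists (\row_k d k).
  have Qfree : row_free Q.
    by rewrite /row_free (eqP Qfull) (size_basis (X := in_tuple X) Xb).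
  apply: simmxW => //; apply/row_matrixP => k.
  rewrite !row_mul row_diag_mx rowK mxE -scalemxAl -rowE rowK.
  by rewrite -(rVof_app e eb) dP linearZ.
exists [seq vecof e (row k P) | k : 'I_(\dim {:V})].
  rewrite basisEdim size_map size_enum_ord leqnn andbT.
  apply/subvP => v _; rewrite -(rVofK eb v) -[rVof e v](mulmxKV Pu).
  rewrite mulmx_sum_row linear_sum /=; apply: memv_suml => k _.
  by rewrite linearZ /= memvZ // memv_span //; apply/mapP; exists k; rewrite ?mem_enum.
move=> _ /mapP[k _ ->] f fs_f.
have /diagonalizable_forPex[d /(simmxP Pu)] := PM _ (map_f M fs_f).
move=> /(congr1 (row k)); rewrite !row_mul row_diag_mx -scalemxAl -rowE => h.
exists (d 0 k); apply: (can_inj (rVofK eb)).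
by rewrite (rVof_app e eb) (vecofK eb) h linearZ /= (vecofK eb).
Qed.
End Codiagonalization.

Section LieAlgebra.
Context (K : fieldType) (g : finLieAlgType K).
Implicit Types x y z u : g.

HB.instance Definition _ x := GRing.isLinear.Build K g g *:%R (lie x)
  (fun c y z => lie_linearr c y z x).

Lemma lieDl x y z : lie (x + y) z = lie x z + lie y z.
Proof. by rewrite -[x]scale1r lie_linearl !scale1r. Qed.

Lemma lie0l z : lie 0 z = 0.
Proof. by apply: (addrI (lie 0 z)); rewrite -lieDl !addr0. Qed.

Lemma lieZl c x z : lie (c *: x) z = c *: lie x z.
Proof. by rewrite -[c *: x]addr0 lie_linearl lie0l addr0. Qed.

Lemma lieC x y : lie x y = - lie y x.
Proof.
apply/eqP; rewrite -addr_eq0; apply/eqP.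
by have := liexx (x + y); rewrite lieDl !linearD /= !liexx add0r addr0.
Qed.

Lemma lieA x y z : lie x (lie y z) = lie (lie x y) z + lie y (lie x z).
Proof.
have /eqP := lie_jacobi x y z; rewrite -addrA addr_eq0 => /eqP ->.
by rewrite opprD addrC (lieC z) opprK (lieC z x) linearN opprK.
Qed.

End LieAlgebra.

Section Weights.
Context (K : numFieldType) (g : finLieAlgType K) (h : {vspace g}).
Hypothesis hC : cartan_subalgebra h.
Implicit Types (a b : dual h) (u t : subvs_of h) (x y v w : g).

Lemma dualD a b u : (a + b) u = a u + b u :> K. Proof. by rewrite add_lfunE. Qed.
Lemma dualN a u : (- a) u = - a u :> K. Proof. by rewrite opp_lfunE. Qed.
Lemma dualB a b u : (a - b) u = a u - b u :> K.
Proof. by rewrite dualD dualN. Qed.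
Lemma dualMn a n u : (a *+ n) u = a u *+ n :> K.
Proof. by elim: n => [|n IH]; rewrite ?mulr0n ?zero_lfunE // !mulrS dualD IH. Qed.
Lemma dualMz a (n : int) u : (a *~ n) u = a u *~ n :> K.
Proof. by case: n => n; rewrite /intmul ?dualN dualMn. Qed.
Lemma dualZ (c : K) a u : (c *: a) u = c * a u :> K.
Proof. by rewrite scale_lfunE. Qed.

Lemma dualZr a (c : K) u : a (c *: u) = c * a u :> K.
Proof. by rewrite linearZ. Qed.
Lemma dualDr a u t : a (u + t) = a u + a t :> K.
Proof. by rewrite linearD. Qed.
Lemma dualNr a u : a (- u) = - a u :> K.
Proof. by rewrite linearN. Qed.

Lemma root_space_lie a b x y :
  root_space a x -> root_space b y -> root_space (a + b) (lie x y).
Proof.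
move=> xa yb u; rewrite lieA xa yb lieZl linearZ /= -scalerDl.
by rewrite dualD.
Qed.

Lemma root_space_iter a b x v n : root_space a x -> root_space b v ->
  root_space (b + a *+ n) (iter n (lie x) v).
Proof.
move=> xa vb; elim: n => [|n IH]; first by rewrite addr0.
by rewrite iterS mulrS addrCA; apply: root_space_lie.
Qed.

Lemma root_spaceZ a c x : root_space a x -> root_space a (c *: x).
Proof. by move=> xa u; rewrite linearZ /= xa !scalerA mulrC. Qed.

Lemma root_space0 x : root_space (0 : dual h) x <-> x \in h.
Proof.
have [hab hcent _] := hC; split=> [x0|xh u].
  apply: hcent => u uh; have := x0 (Subvs uh).
  by rewrite zero_lfunE scale0r.
by rewrite zero_lfunE scale0r hab // subvsP.
Qed.

Lemma eigenvalues_finite u : exists s : seq K,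
  forall (c : K) v, v <> 0 -> lie (vsval u) v = c *: v -> c \in s.
Proof.
have [_ _ /(_ _ (subvsP u)) [X Xb Xu]] := hC.
have/fin_all_exists [d dP] (k : 'I_(size X)) : exists a : K,
    lie (vsval u) (tnth (in_tuple X) k) = a *: tnth (in_tuple X) k.
  by apply: Xu; rewrite mem_tnth.
exists (codom d) => c v /eqP v0 uv.
have vE := coord_basis (X := in_tuple X) Xb (memvf v).
have Xfree : free (in_tuple X) := basis_free Xb.
have [/existsP[k ck]|/existsPn nc] :=
    boolP [exists k, coord (in_tuple X) k v != 0]; last first.
  move: v0; rewrite vE big1 ?eqxx // => k _.
  by have := nc k; rewrite negbK => /eqP ->; rewrite scale0r.
have: coord (in_tuple X) k (lie (vsval u) v) = c * coord (in_tuple X) k v.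
  by rewrite uv linearZ.
rewrite {1}vE linear_sum /=.
rewrite (eq_bigr (fun i => (d i * coord (in_tuple X) i v) *: (in_tuple X)`_i)).
  rewrite coord_sum_free // => /(mulIf ck) <-; exact: codom_f.
move=> i _; have := dP i; rewrite (tnth_nth 0) linearZ /= => ->.
by rewrite scalerA mulrC.
Qed.

(** Nonzero iterates would be eigenvectors of some [u] with [a u] nonzero, for infinitely many
    distinct eigenvalues [b u + a u *+ n]. *)
Lemma root_nilpotent a b x v : a <> 0 -> root_space a x -> root_space b v ->
  exists n, iter n (lie x) v = 0.
Proof.
move=> a0 xa vb.
have [u au] : exists u, a u != 0 :> K.
  apply: contra_notP a0 => /forallNP au; apply/lfunP => u.
  by rewrite zero_lfunE; have /negP := au u; rewrite negbK => /eqP.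
have [s sP] := eigenvalues_finite u.
apply: contrapT => /forallNP nz.
have inj : injective (fun n => b u + a u *+ n).
  by move=> m n /addrI /(mulrIn au).
have us : uniq (map (fun n => b u + a u *+ n) (iota 0 (size s).+1)).
  by rewrite map_inj_uniq ?iota_uniq.
have := @uniq_leq_size _ _ s us.
rewrite size_map size_iota ltnn => H; suff: false by []; apply: H.
move=> _ /mapP[n _ ->]; apply: (sP _ _ (nz n)).
by rewrite (root_space_iter n xa vb) dualD dualMn.
Qed.

Lemma root_raise a b x v : a <> 0 -> root_space a x -> root_space b v ->
  v <> 0 -> exists r, iter r (lie x) v <> 0 /\ lie x (iter r (lie x) v) = 0.
Proof.
move=> a0 xa vb v0.
have [n0 n0P] := root_nilpotent a0 xa vb.
have ex : exists n, iter n (lie x) v == 0 by exists n0; apply/eqP.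
case: (ex_minnP ex) => -[|r] /eqP rP rmin; first by case: v0.
exists r; split => //; move/eqP => /rmin; by rewrite ltnn.
Qed.

(* With [a t = 2] this is the sl2 ladder, with [a t = 0] the Heisenberg one. *)
Lemma ladder a b x y t v :
  a <> 0 -> root_space a x -> root_space (- a) y -> lie x y = vsval t ->
  root_space b v -> v <> 0 -> lie x v = 0 ->
  exists N : nat, b t = N%:R * (a t / 2) :> K /\
    forall k, (k <= N)%N -> iter k (lie y) v <> 0.
Proof.
move=> a0 xa ya xy vb v0 xv.
have ina : - a <> 0 by move/eqP; rewrite oppr_eq0 => /eqP.
have [N [NP N0]] := root_raise ina ya vb v0.
exists N; split; last first.
  move=> k kN kz; apply: NP; rewrite -(subnK kN) iterD kz.
  by elim: (N - k)%N => //= n ->; rewrite linear0.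
(* At [k = N] the left side vanishes while [iter N (lie y) v] does not, so the coefficient must be
   0, which gives [b t]. *)
have step k : lie x (iter k.+1 (lie y) v) =
    (k.+1%:R * (b t - k%:R * (a t / 2))) *: iter k (lie y) v.
  elim: k => [|k IH].
    by rewrite /= lieA xv linear0 addr0 xy vb mul0r subr0 mul1r.
  rewrite iterS lieA xy (root_space_iter k.+1 ya vb) IH linearZ /=.
  rewrite -scalerDl; congr (_ *: _); rewrite dualD dualMn dualN /=.
  by rewrite -[- _ *+ _]mulr_natr -[k.+2]addn1 -[k.+1]addn1 !natrD; field.
have := step N; rewrite iterS N0 linear0 => /esym/eqP.
rewrite scaler_eq0 mulf_eq0 pnatr_eq0 /= subr_eq0 => /orP[/eqP //|/eqP //].
Qed.

(** Climb [r] steps to a vector killed by [x], then go down the [N] steps of [ladder]; the formula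
    for [b t] is the one for the top weight [b + a *+ r]. *)
Lemma root_string a b x y t v :
  a <> 0 -> root_space a x -> root_space (- a) y -> lie x y = vsval t ->
  root_space b v -> v <> 0 ->
  exists N r : nat, b t = (N%:R - 2 * r%:R) * (a t / 2) :> K /\
    forall k, (k <= N)%N -> exists2 w, root_space (b + a *+ r - a *+ k) w & w <> 0.
Proof.
move=> a0 xa ya xy vb v0.
have [r [r0 rP]] := root_raise a0 xa vb v0.
have [N [bN NP]] := ladder a0 xa ya xy (root_space_iter r xa vb) r0 rP.
exists N, r; split.
  by move: bN; rewrite dualD dualMn -mulr_natr => /(canRL (addrK _)) ->; field.
move=> k /NP kP; exists (iter k (lie y) (iter r (lie x) v)) => //.
by rewrite -mulNrn; apply: root_space_iter => //; apply: root_space_iter.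
Qed.

Lemma weight_basis : exists (X : (\dim {:g}).-tuple g) (wt : 'I_(\dim {:g}) -> dual h),
  basis_of fullv X /\ forall k, root_space (wt k) (tnth X k).
Proof.
have [hab hcent hdiag] := hC.
have vm z : z \in vbasis h -> z \in h by exact: vbasis_mem.
have [|_ /mapP[u uh ->]|X0 Xb Xe] :=
    @codiagonalizable_basis K g [seq linfun (lie z) | z <- vbasis h].
- move=> _ _ /mapP[u uh ->] /mapP[v vh ->] x; rewrite !lfunE /= lieA.
  by rewrite (hab _ _ (vm _ uh) (vm _ vh)) lie0l add0r.
- have [X Xb Xu] := hdiag u (vm _ uh); exists X => // x /Xu [a ax].
  by exists a; rewrite lfunE.
have sX : size X0 == \dim {:g} by rewrite -(size_basis (X := in_tuple X0) Xb).
pose X : (\dim {:g}).-tuple g := Tuple sX.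
have Xfree : free X := basis_free Xb.
have ev k u : exists a : K, lie (vsval u) (tnth X k) = a *: tnth X k.
  have Xk : tnth X k \in X0 by exact: mem_tnth.
  have/fin_all_exists [d dP] (i : 'I_(\dim h)) : exists a : K,
      lie (vbasis h)`_i (tnth X k) = a *: tnth X k.
    have iv : (vbasis h)`_i \in vbasis h by rewrite mem_nth ?size_tuple.
    have [a aP] := Xe _ Xk _ (map_f (fun z => linfun (lie z)) iv).
    by exists a; move: aP; rewrite lfunE.
  exists (\sum_i coord (vbasis h) i (vsval u) * d i).
  rewrite {1}(coord_vbasis (subvsP u)) lieC linear_sum -sumrN scaler_suml /=.
  apply: eq_bigr => i _; rewrite linearZ /= -scalerN -lieC dP scalerA //.
(* Reading the weight of the [k]-th basis vector as a coordinate makes its linearity in [u]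
   immediate. *)
pose f k (u : subvs_of h) : K^o := coord X k (lie (vsval u) (tnth X k)).
have flin k : linear (f k).
  by move=> c u v; rewrite /f linearP lie_linearl linearP.
pose F k : {linear subvs_of h -> K^o} :=
  HB.pack (f k) (GRing.isLinear.Build K (subvs_of h) K^o *:%R (f k) (flin k)).
exists X, (fun k => linfun (F k)); split => // k u.
rewrite lfunE /= /f; have [a ->] := ev k u.
by rewrite linearZ /= (tnth_nth 0) coord_free // eqxx mulr1.
Qed.
End Weights.

(** * The Killing form *)

Section Killing.
Context (K : numFieldType) (g : finLieAlgType K) (h : {vspace g}).
Hypothesis hC : cartan_subalgebra h.
Implicit Types (a b : dual h) (u t : subvs_of h) (x y v w : g).

Context (X : (\dim {:g}).-tuple g) (wt : 'I_(\dim {:g}) -> dual h).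
Hypothesis Xb : basis_of fullv X.
Hypothesis Xwt : forall k, root_space (wt k) (tnth X k).

Lemma Xfree : free X. Proof. exact: basis_free Xb. Qed.

Lemma weight_mem a v : root_space a v -> v <> 0 -> exists k, a = wt k.
Proof.
move=> va /eqP v0; have vE := coord_basis Xb (memvf v).
have [/existsP[k ck]|/existsPn nc] := boolP [exists k, coord X k v != 0]; last first.
  move: v0; rewrite vE big1 ?eqxx // => k _.
  by have := nc k; rewrite negbK => /eqP ->; rewrite scale0r.
exists k; apply/lfunP => u; apply: (mulIf ck).
transitivity (coord X k (lie (vsval u) v)); first by rewrite va linearZ.
rewrite {1}vE linear_sum /=.
rewrite (eq_bigr (fun i => (wt i u * coord X i v) *: X`_i)).
  by rewrite coord_sum_free // Xfree.
by move=> i _; rewrite linearZ /= -tnth_nth Xwt scalerA mulrC.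
Qed.

Definition killing x y : K :=
  \tr (mxof X X (linfun (lie x)) *m mxof X X (linfun (lie y))).
Local Notation kap := killing.

Lemma killingC x y : kap x y = kap y x.
Proof. exact: mxtrace_mulC. Qed.

Lemma killingP c x y z : kap (c *: x + y) z = c * kap x z + kap y z.
Proof.
rewrite /kap.
have -> : linfun (lie (c *: x + y)) = c *: linfun (lie x) + linfun (lie y).
  by apply/lfunP => w; rewrite add_lfunE scale_lfunE !lfunE /= lie_linearl.
by rewrite linearP mulmxDl -scalemxAl linearP.
Qed.

Lemma killing_is_linear x : linear (kap x : g -> K^o).
Proof. by move=> c y z; rewrite /= 3!(killingC x) killingP. Qed.
HB.instance Definition _ x := GRing.isLinear.Build K g K^o *:%R (kap x)
  (killing_is_linear x).

Lemma killingZl c x y : kap (c *: x) y = c * kap x y.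
Proof. by rewrite !(killingC _ y) linearZ. Qed.

Lemma killingZr c x y : kap x (c *: y) = c * kap x y.
Proof. by rewrite killingC killingZl killingC. Qed.

Lemma killingA x y z : kap (lie x y) z = kap x (lie y z).
Proof.
have M x' y' : mxof X X (linfun (lie (lie x' y'))) =
    mxof X X (linfun (lie y')) *m mxof X X (linfun (lie x')) -
    mxof X X (linfun (lie x')) *m mxof X X (linfun (lie y')).
  rewrite -!(mxof_comp _ _ Xb) -linearB; congr mxof; apply/lfunP => w.
  rewrite add_lfunE opp_lfunE !comp_lfunE !lfunE /=.
  by rewrite lieA addrK.
rewrite /kap !M mulmxBl mulmxBr !raddfB /=; congr (_ - _).
  by rewrite -mulmxA mxtrace_mulC mulmxA.
by rewrite mulmxA.
Qed.

Lemma killing_cartan u t : kap (vsval u) (vsval t) = \sum_k wt k u * wt k t.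
Proof.
have M s : mxof X X (linfun (lie (vsval s))) = diag_mx (\row_k wt k s).
  apply/row_matrixP => k; rewrite !rowE mul_mxof vecof_delta lfunE /=.
  by rewrite -tnth_nth Xwt linearZ /= (tnth_nth 0) rVofE // -rowE row_diag_mx mxE.
rewrite /kap !M mulmx_diag mxtrace_diag; apply: eq_bigr => k _.
by rewrite !mxE.
Qed.

(** Invariance of the form under [lie u] gives [(a u + b u) * killing x y = 0] for every [u]. *)
Lemma killing_orth a b x y :
  root_space a x -> root_space b y -> a + b <> 0 -> kap x y = 0.
Proof.
move=> xa yb ab; apply: contrapT => /eqP kxy; apply: ab; apply/lfunP => u.
apply: (mulIf kxy); rewrite dualD zero_lfunE mul0r mulrDl.
rewrite -{1}(killingZl (a u)) -xa lieC -killingC linearN /= killingC killingA.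
by rewrite yb linearZ addNr.
Qed.

Hypothesis hg : simple_lie g.
Variable a0 : dual h.
Hypothesis a0r : is_root a0.
Hypothesis a0c : a0 (coroot a0) = 2%:R :> K.

Lemma corootP a : a (coroot a) = 2%:R :> K -> exists x y,
  [/\ root_space a x, root_space (- a) y & vsval (coroot a) = lie x y].
Proof.
rewrite /coroot; case: xgetP => [u -> [] //|_ /eqP].
by rewrite linear0 eq_sym pnatr_eq0.
Qed.

Lemma weight_coroot_int a b v : is_root a -> a (coroot a) = 2%:R :> K ->
  root_space b v -> v <> 0 -> exists m : int, b (coroot a) = m%:~R :> K.
Proof.
move=> [an0 _] ac vb v0; have [x [y [xa ya xy]]] := corootP ac.
have [N [r [bE _]]] := root_string hC an0 xa ya (esym xy) vb v0.
exists (N%:Z - 2 * r%:Z); rewrite bE ac divff ?pnatr_eq0 // mulr1.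
by rewrite rmorphB rmorphM.
Qed.

(** Every weight takes an integer value on the coroot, so the trace is a sum of squares, to which
    the weight [a] itself contributes 4. *)
Lemma killing_coroot_gt0 a : is_root a -> a (coroot a) = 2%:R :> K ->
  0 < kap (vsval (coroot a)) (vsval (coroot a)).
Proof.
move=> ar ac; rewrite killing_cartan.
have sq k : 0 <= wt k (coroot a) * wt k (coroot a) :> K.
  have [|m ->] := weight_coroot_int ar ac (Xwt k).
    by apply/eqP; rewrite (tnth_nth 0) (free_not0 Xfree) // mem_nth ?size_tuple.
  by rewrite -expr2 -rmorphXn /= ler0z sqr_ge0.
rewrite lt_def sumr_ge0 // andbT; apply/negP => /eqP.
move=> /(psumr_eq0P (fun k _ => sq k)) z.
have [_ [x xa x0]] := ar; have [k ak] := weight_mem xa x0.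
have /eqP := z k isT; rewrite -ak ac mulf_eq0 pnatr_eq0 //.
Qed.

Lemma killing_nondeg x : (forall y, kap x y = 0) -> x = 0.
Proof.
have [_ hgU] := hg.
pose f x := \row_k kap x (tnth X k).
have flin : linear f.
  by move=> c y z; apply/rowP => k; rewrite !mxE killingP.
pose F : {linear g -> 'rV[K]_(\dim {:g})} :=
  HB.pack f (GRing.isLinear.Build K g _ *:%R f flin).
have memU z : (z \in lker (linfun F)) <-> forall y, kap z y = 0.
  rewrite memv_ker lfunE; split=> [/eqP/rowP zX y|zy].
    rewrite (coord_basis Xb (memvf y)) linear_sum big1 // => k _.
    by rewrite /= killingZr; have := zX k; rewrite !mxE (tnth_nth 0) => ->; rewrite mulr0.
  by apply/eqP/rowP => k; rewrite !mxE.
move=> xz; case: (hgU (lker (linfun F))) => [y z /(memU _).1 zz|U0|U1].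
- apply: (memU _).2 => w; by rewrite lieC killingC linearN /= -killingC killingA zz oppr0.
- have : x \in lker (linfun F) by apply: (memU _).2.
  by rewrite U0 memv0 => /eqP.
have := killing_coroot_gt0 a0r a0c.
have U0 : vsval (coroot a0) \in lker (linfun F) by rewrite U1 memvf.
by rewrite ((memU _).1 U0) ltxx.
Qed.

Lemma killing_dual_vector a x : root_space a x -> x <> 0 ->
  exists2 y, root_space (- a) y & kap x y <> 0.
Proof.
move=> xa x0.
have [k kx] : exists k, kap x (tnth X k) <> 0.
  apply: contra_notP x0 => /forallNP xk; apply: killing_nondeg => y.
  rewrite (coord_basis Xb (memvf y)) linear_sum big1 // => k _.
  by have /contrapT := xk k; rewrite /= killingZr (tnth_nth 0) => ->; rewrite mulr0.
exists (tnth X k) => //; have := Xwt k.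
suff -> : - a = wt k by [].
apply/eqP; rewrite eq_sym -subr_eq0 opprK addrC; apply/eqP.
by apply: contrapT => /(killing_orth xa (Xwt k)).
Qed.

Lemma is_rootN a : is_root a -> is_root (- a).
Proof.
move=> [a1 [x xa x0]]; split; first by move/eqP; rewrite oppr_eq0 => /eqP.
have [y ya xy] := killing_dual_vector xa x0; exists y => // y0.
by apply: xy; rewrite y0 linear0.
Qed.

Lemma killing_cartan_nondeg u :
  (forall t, kap (vsval u) (vsval t) = 0) -> u = 0.
Proof.
move=> ut; suff u0 : vsval u = 0 by apply: subvs_inj; rewrite u0 linear0.
apply: killing_nondeg => y.
rewrite (coord_basis Xb (memvf y)) linear_sum big1 // => k _.
rewrite /= killingZr -tnth_nth.
have [w0|w0] := pselect (wt k = 0); last first.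
  rewrite (@killing_orth 0 (wt k)) ?mulr0 //; last by rewrite add0r.
  by apply/(root_space0 hC); apply: subvsP.
have := Xwt k; rewrite w0 => /(root_space0 hC) Xh.
by rewrite -[tnth X k]/(vsval (Subvs Xh)) ut mulr0.
Qed.

Definition killing_on u t : K^o := kap (vsval u) (vsval t).

Lemma killing_on_linear u : linear (killing_on u).
Proof. by move=> c s t; rewrite /killing_on [vsval (_ + _)]linearP; apply: killing_is_linear. Qed.
HB.instance Definition _ u := GRing.isLinear.Build K (subvs_of h) K^o *:%R
  (killing_on u) (killing_on_linear u).

Definition killing_dual u : dual h := linfun (killing_on u).

Lemma killing_dualE u t : killing_dual u t = kap (vsval u) (vsval t).
Proof. by rewrite lfunE. Qed.

Lemma killing_dual_linear : linear killing_dual.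
Proof.
move=> c u t; apply/lfunP => s.
by rewrite add_lfunE scale_lfunE !killing_dualE linearP killingP.
Qed.

HB.instance Definition _ := GRing.isLinear.Build K (subvs_of h) (dual h) *:%R
  killing_dual killing_dual_linear.

(** The identification of the dual of [h] with [h]; [a (tau b)] is the induced symmetric form on
    weights. *)
Definition killing_inv : 'Hom(dual h, subvs_of h) := ((linfun killing_dual)^-1)%VF.
Local Notation tau := killing_inv.

Lemma killing_dual_inj : injective killing_dual.
Proof.
move=> s t st; apply/eqP; rewrite -subr_eq0; apply/eqP/killing_cartan_nondeg => u.
by rewrite -killing_dualE linearB /= st subrr zero_lfunE.
Qed.

Lemma killing_invK : cancel tau killing_dual.
Proof.
move=> a; rewrite -(lfunE killing_dual); apply: limg_lfunVK.
have kerF : lker (linfun killing_dual) = 0%VS.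
  apply/eqP; rewrite -subv0; apply/subvP => u; rewrite memv_ker lfunE /= memv0.
  by move=> /eqP u0; apply/eqP/killing_dual_inj; rewrite u0 linear0.
suff -> : limg (linfun killing_dual) = fullv by rewrite memvf.
apply/eqP; rewrite eqEdim subvf /=.
have := limg_ker_dim (linfun killing_dual) fullv; rewrite kerF capv0 dimv0 add0n => ->.
by rewrite !dimvf /dim /= muln1.
Qed.

Lemma killing_invE a u : a u = kap (vsval (tau a)) (vsval u).
Proof. by rewrite -killing_dualE killing_invK. Qed.

Lemma killing_inv_sym a b : a (tau b) = b (tau a) :> K.
Proof. by rewrite !killing_invE killingC. Qed.

Lemma killing_inv_inj : injective tau.
Proof. exact: can_inj killing_invK. Qed.

Lemma lie_root_opp a x y : root_space a x -> root_space (- a) y ->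
  lie x y = kap x y *: vsval (tau a).
Proof.
move=> xa ya; have := root_space_lie xa ya; rewrite subrr.
move=> /(root_space0 hC) xyh.
rewrite -[lie x y]/(vsval (Subvs xyh)) -linearZ; congr vsval.
apply: killing_dual_inj; apply/lfunP => u.
rewrite linearZ /= scale_lfunE killing_invK killing_dualE /= killingA lieC ya.
by rewrite dualN scaleNr opprK killingZr; apply: mulrC.
Qed.

(** If [a (tau a)] were 0, then [t], the bracket of [x] and [y], would satisfy [a t = 0]; the
    Heisenberg case of the ladder makes every weight vanish on [t], hence [t = 0] by nondegeneracy,
    although it is a nonzero multiple of [tau a]. *)
Lemma root_norm_neq0 a : is_root a -> a (tau a) <> 0 :> K.
Proof.
move=> [a1 [x xa x0]] at0.
have [y ya xy] := killing_dual_vector xa x0.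
pose t := kap x y *: tau a.
have xyt : lie x y = vsval t by rewrite (lie_root_opp xa ya) linearZ.
have t0 : t = 0.
  apply: killing_cartan_nondeg => u; rewrite killing_cartan big1 // => k _.
  have [|N [r [-> _]]] := root_string hC a1 xa ya xyt (Xwt k).
    by apply/eqP; rewrite (tnth_nth 0) (free_not0 Xfree) // mem_nth ?size_tuple.
  by rewrite /t dualZr at0 mulr0 mul0r mulr0 mul0r.
move/eqP: t0; rewrite scaler_eq0 => /orP[/eqP //|/eqP ta].
by apply: a1; apply: killing_inv_inj; rewrite ta linear0.
Qed.

(** As [a (tau a)] is nonzero, a multiple of [tau a] meets the defining condition of the coroot, so
    [xget] does not return its default. *)
Lemma coroot2 a : is_root a -> a (coroot a) = 2%:R :> K.
Proof.
move=> ar; have [a1 [x xa x0]] := ar.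
have [y ya /eqP xy] := killing_dual_vector xa x0.
have /eqP at0 := root_norm_neq0 ar.
rewrite /coroot.
have := @xgetI _ 0 [set u | a u = 2%:R /\
    exists x y, [/\ root_space a x, root_space (- a) y & vsval u = lie x y]]
  ((2%:R / a (tau a)) *: tau a).
case=> //; split.
  by rewrite dualZr divfK.
exists ((2%:R / a (tau a) / kap x y) *: x), y; split => //; first exact: root_spaceZ.
by rewrite lieZl (lie_root_opp xa ya) scalerA divfK // linearZ.
Qed.

Lemma corootE a : is_root a -> coroot a = (2%:R / a (tau a)) *: tau a.
Proof.
move=> ar; have /eqP at0 := root_norm_neq0 ar.
have [x [y [xa ya xy]]] := corootP (coroot2 ar).
have E : coroot a = kap x y *: tau a.
  by apply: subvs_inj; rewrite linearZ xy (lie_root_opp xa ya).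
have := coroot2 ar; rewrite {1}E dualZr => /(canRL (mulfK at0)) e2.
by rewrite E e2.
Qed.

(** The Killing norm of the coroot, already known to be positive, equals 4 divided by
    [a (tau a)]. *)
Lemma root_norm_gt0 a : is_root a -> 0 < (a (tau a) : K).
Proof.
move=> ar; have /eqP at0 := root_norm_neq0 ar.
have := killing_coroot_gt0 ar (coroot2 ar).
rewrite corootE // [vsval _]linearZ /= killingZl killingZr -killing_invE.
have -> : 2%:R / a (tau a) * (2%:R / a (tau a) * a (tau a)) = 4%:R * (a (tau a))^-1 :> K.
  by field.
by rewrite pmulr_rgt0 ?ltr0n // invr_gt0.
Qed.

Lemma root_pairing_int a b : is_root a -> is_root b ->
  exists m : int, b (coroot a) = m%:~R :> K.
Proof.
move=> ar [_ [v vb v0]]; exact: (weight_coroot_int ar (coroot2 ar) vb v0).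
Qed.

(** If [b = a *~ m], pairing with the coroot gives [m = 2 * m], so [m = 0] and [b = 0]. *)
Lemma root_neq_mulz a b (m : int) : is_root a -> is_root b ->
  b (coroot a) = m%:~R :> K -> b - a *~ m <> 0.
Proof.
move=> ar [b0 _] bm /eqP; rewrite subr_eq0 => /eqP bE; apply: b0.
have : b (coroot a) = b (coroot a) + b (coroot a) :> K.
  rewrite {1}bE dualMz coroot2 // bm -mulrzl mulrC -[2%:R]/(1 + 1) mulrDl !mul1r //.
move=> /esym/eqP; rewrite -subr_eq0 addrK bm intr_eq0 => /eqP m0.
by rewrite bE m0 mulr0z.
Qed.

Lemma root_reflect a b (m : int) : is_root a -> is_root b ->
  b (coroot a) = m%:~R :> K -> is_root (b - a *~ m).
Proof.
move=> ar; wlog m0 : b m / (0 <= m).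
  move=> H br bm; have [|m0] := lerP 0 m; first by move=> ?; exact: H.
  have := H (- b) (- m); rewrite oppr_ge0 (ltW m0) => /(_ isT (is_rootN br)).
  rewrite dualN bm rmorphN => /(_ erefl) /is_rootN.
  by rewrite mulrNz !opprK opprD opprK.
move=> br bm; have [b1 [v vb v0]] := br.
have [a1 _] := ar; have [x [y [xa ya xy]]] := corootP (coroot2 ar).
have [N [r [bE Nr]]] := root_string hC a1 xa ya (esym xy) vb v0.
have mE : m = N%:Z - 2 * r%:Z.
  apply: (@intr_inj K); rewrite -bm bE coroot2 // divff ?pnatr_eq0 // mulr1.
  by rewrite rmorphB rmorphM.
(* With [k = N - r], going up [r] steps and down [k] subtracts [N - 2r = m] times [a]; since
   [m >= 0] forces [N >= 2r], the truncated subtraction is exact. *)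
have [|w wa w0] := Nr (N - r)%N; first by lia.
split; first exact: root_neq_mulz.
exists w => //; move: wa; congr (root_space _ w); rewrite -addrA; congr (_ + _).
rewrite !pmulrn -mulrzBr -mulrNz; congr (_ *~ _).
by rewrite mE; lia.
Qed.

(** Subtract the multiple of [x] that leaves [w'] orthogonal to [y]. Then [lie y w' = 0], and the
    ladder with [y] in the raising role would make -2 a natural number unless [w' = 0]. *)
Lemma root_space_line a x y w : is_root a -> root_space a x -> root_space (- a) y ->
  vsval (coroot a) = lie x y -> root_space a w -> exists c : K, w = c *: x.
Proof.
move=> ar xa ya xy wa; have [a1 _] := ar.
have xy0 : kap x y != 0.
  apply/eqP => xy0; have := coroot2 ar.
  have -> : coroot a = 0 by apply: subvs_inj; rewrite xy (lie_root_opp xa ya) xy0 scale0r linear0.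
  by rewrite linear0 => /esym/eqP; rewrite pnatr_eq0.
exists (kap w y / kap x y); apply/eqP; rewrite -subr_eq0; apply/eqP.
set c := _ / _; set w' := _ - _.
have w'a : root_space a w'.
  by move=> u; rewrite /w' linearB linearZ /= wa xa !scalerA mulrC -scalerA scalerBr.
have yw : lie y w' = 0.
  have w'E : (- c) *: x + w = w' by rewrite /w' addrC scaleNr.
  rewrite lieC (lie_root_opp w'a ya) -w'E killingP mulNr divfK //.
  by rewrite addNr scale0r oppr0.
apply: contrapT => w0.
have ina : - a <> 0 by move/eqP; rewrite oppr_eq0 => /eqP.
have yx : lie y x = vsval (- coroot a) by rewrite linearN /= xy -lieC.
have xa' : root_space (- - a) x by rewrite opprK.
have [N [aN _]] := ladder hC ina ya xa' yx w'a w0 yw.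
move: aN; rewrite dualN dualNr coroot2 // opprK divff ?pnatr_eq0 // mulr1.
move/eqP; rewrite eq_sym -subr_eq0 opprK -natrD pnatr_eq0 addn2 //.
Qed.

Lemma coroot_muln a k : is_root a -> is_root (a *+ k) ->
  coroot (a *+ k) = k%:R^-1 *: coroot a.
Proof.
move=> ar kr; have [k1 _] := kr; have /eqP at0 := root_norm_neq0 ar.
have k0 : k%:R != 0 :> K by rewrite pnatr_eq0; apply/eqP => k0; apply: k1; rewrite k0.
have tk : tau (a *+ k) = k%:R *: tau a by rewrite raddfMn scaler_nat.
have nk : (a *+ k) (tau (a *+ k)) = k%:R * (k%:R * a (tau a)) :> K.
  by rewrite tk dualZr dualMn !mulr_natl.
rewrite !corootE // nk tk !scalerA; congr (_ *: _); field.
by rewrite k0 at0.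
Qed.

(** The value of [a] on the coroot of [a *+ k] is 2/k and must be an integer, so [k] divides 2. *)
Lemma root_muln_le2 a k : is_root a -> is_root (a *+ k) -> (k <= 2)%N.
Proof.
move=> ar kr; have [m] := root_pairing_int kr ar.
have [k1 _] := kr.
have k0 : k%:R != 0 :> K by rewrite pnatr_eq0; apply/eqP => k0; apply: k1; rewrite k0.
rewrite coroot_muln // dualZr coroot2 // => /(congr1 (fun c => k%:R * c)).
rewrite mulVKf //.
rewrite -[2%:R]/(2%:Z%:~R) -[k%:R]/(k%:Z%:~R) -rmorphM => /intr_inj.
move=> /(congr1 absz); rewrite abszM /= => e.
by apply: dvdn_leq => //; apply/dvdnP; exists `|m|%N; rewrite e mulnC.
Qed.

(** For [z] of weight [a *+ 2], [lie x z] has the excluded weight [a *+ 3], and [lie y z] is a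
    multiple of [x]; hence [lie x (lie y z)] is both 0 and [4 z]. *)
Lemma root_double a : is_root a -> ~ is_root (a *+ 2).
Proof.
move=> ar [a21 [z za z0]]; have [a1 _] := ar.
have [x [y [xa ya xy]]] := corootP (coroot2 ar).
have r3 : ~ is_root (a *+ 3) by move=> /(root_muln_le2 ar).
have xz : lie x z = 0.
  apply: contrapT => xz; apply: r3; split.
    by apply/eqP; rewrite -scaler_nat scaler_eq0 pnatr_eq0 /=; apply/eqP.
  by exists (lie x z) => //; rewrite mulrS; apply: root_space_lie.
have yz : root_space a (lie y z).
  by have := root_space_lie ya za; rewrite mulrS addKr.
have [c yzE] := root_space_line ar xa ya xy yz.
have : lie x (lie y z) = 4%:R *: z.
  by rewrite lieA xz linear0 addr0 -xy za dualMn coroot2 // -mulrnA.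
rewrite yzE linearZ /= liexx scaler0 => /esym/eqP.
by rewrite scaler_eq0 pnatr_eq0 /= => /eqP.
Qed.

Lemma root_reduced a k : is_root a -> is_root (a *+ k) -> k = 1%N.
Proof.
move=> ar kr; have := root_muln_le2 ar kr; have [k1 _] := kr.
case: k kr k1 => [|[|[|k]]] //.
by move=> /(root_double ar).
Qed.

Lemma roots_finite a : is_root a -> a \in codom wt.
Proof. by move=> [_ [x xa x0]]; have [k ->] := weight_mem xa x0; apply: codom_f. Qed.

End Killing.

(** A reduced crystallographic root system with the form [a (tau b)]: the interface that frees the
    later arguments from weight bases and traces. *)
Record root_geometry (K : numFieldType) (g : finLieAlgType K) (h : {vspace g})
  (tau : 'Hom(dual h, subvs_of h)) : Prop := RootGeometry {
  tau_inj : injective tau;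
  tau_sym : forall a b : dual h, a (tau b) = b (tau a) :> K;
  norm_gt0 : forall a : dual h, is_root a -> 0 < (a (tau a) : K);
  coroot_tau : forall a : dual h, is_root a -> coroot a = (2%:R / a (tau a)) *: tau a;
  pairing_int : forall a b : dual h, is_root a -> is_root b ->
    exists2 m : int, b (coroot a) = m%:~R :> K & is_root (b - a *~ m);
  rootN : forall a : dual h, is_root a -> is_root (- a);
  reduced : forall (a : dual h) k, is_root a -> is_root (a *+ k) -> k = 1%N;
  finite_roots : exists s : seq (dual h), forall a, is_root a -> a \in s
}.

Theorem root_geometry_exists (K : numFieldType) (g : finLieAlgType K) (h : {vspace g})
    (hg : simple_lie g) (hC : cartan_subalgebra h) (a0 : dual h) :
  is_root a0 -> a0 (coroot a0) = 2%:R :> K ->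
  exists tau : 'Hom(dual h, subvs_of h), @root_geometry K g h tau.
Proof.
move=> a0r a0c; have [X [wt [Xb Xwt]]] := weight_basis hC.
exists (killing_inv h X); split.
- exact: (killing_inv_inj hC Xb Xwt hg a0r a0c).
- exact: (killing_inv_sym hC Xb Xwt hg a0r a0c).
- exact: (root_norm_gt0 hC Xb Xwt hg a0r a0c).
- exact: (corootE hC Xb Xwt hg a0r a0c).
- move=> a b ar br.
  have [m bm] := root_pairing_int hC Xb Xwt hg a0r a0c ar br.
  by exists m => //; apply: (root_reflect hC Xb Xwt hg a0r a0c).
- exact: (is_rootN hC Xb Xwt hg a0r a0c).
- exact: (root_reduced hC Xb Xwt hg a0r a0c).
by exists (codom wt) => a; apply: (roots_finite Xb Xwt).
Qed.

(** * Bases of the root system *)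

Lemma free_familyP (K : fieldType) (V : vectType K) (J : finType) (B' : J -> V) :
  free [seq B' j | j : J] <->
  forall k : J -> K, \sum_j k j *: B' j = 0 -> forall j, k j = 0.
Proof.
pose X := [tuple of [seq B' j | j : J]].
have XE k : \sum_(i < #|J|) k i *: X`_i = \sum_j k (enum_rank j) *: B' j.
  rewrite (reindex (@enum_rank J)) /=; last exact/onW_bij/enum_rank_bij.
  apply: eq_bigr => j _; congr (_ *: _).
  by rewrite (nth_map j) ?nth_enum_rank // -cardE.
split=> [fX k k0 j|H].
  have /freeP/(_ (fun i => k (enum_val i))) : free X by exact: fX.
  rewrite XE // => H; rewrite -(enum_rankK j); apply: H.
  by rewrite -[RHS]k0; apply: eq_bigr => i _; rewrite enum_rankK.
suff : free X by [].
apply/freeP => k; rewrite XE // => /H k0 i.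
by rewrite -(enum_valK i).
Qed.

Section RootBases.
Context (K : numFieldType) (g : finLieAlgType K) (h : {vspace g}).
Context (tau : 'Hom(dual h, subvs_of h)).
Hypothesis G : root_geometry tau.
Implicit Types (a b c : dual h).

Definition refl a b : dual h := b - (b (coroot a) : K) *: a.

Lemma norm_neq0 a : is_root a -> a (tau a) != 0 :> K.
Proof. by move=> /(norm_gt0 G) /lt0r_neq0. Qed.

Lemma pairingE a b : is_root a -> b (coroot a) = 2%:R * b (tau a) / a (tau a) :> K.
Proof. by move=> ar; rewrite (coroot_tau G) // dualZr mulrAC. Qed.

Lemma pairing_self a : is_root a -> a (coroot a) = 2%:R :> K.
Proof. by move=> ar; rewrite pairingE // mulfK // norm_neq0. Qed.

Lemma refl_is_linear a : linear (refl a).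
Proof.
move=> k b c; rewrite /refl dualD dualZ scalerBr !scalerDl !scalerA opprD.
by rewrite addrACA.
Qed.
HB.instance Definition _ a := GRing.isLinear.Build K (dual h) (dual h) *:%R
  (refl a) (refl_is_linear a).

Lemma refl_self a : is_root a -> refl a a = - a.
Proof.
by move=> ar; rewrite /refl pairing_self // scaler_nat mulr2n opprD addrA subrr sub0r.
Qed.

Lemma reflK a : is_root a -> involutive (refl a).
Proof.
move=> ar b; rewrite {2}/refl linearB linearZ /= refl_self // scalerN opprK.
exact: subrK.
Qed.

Lemma reflE a b (m : int) : b (coroot a) = m%:~R :> K -> refl a b = b - a *~ m.
Proof. by rewrite /refl => ->; rewrite scaler_int. Qed.

Lemma refl_root a b : is_root a -> is_root b -> is_root (refl a b).
Proof. by move=> ar br; have [m /reflE ->] := pairing_int G ar br. Qed.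

Lemma refl_isometry a b c : is_root a ->
  refl a b (tau (refl a c)) = b (tau c) :> K.
Proof.
move=> ar; have n0 := norm_neq0 ar.
have tE : tau (refl a c) = tau c - (c (coroot a) : K) *: tau a.
  by rewrite /refl linearB linearZ.
rewrite tE !dualDr !dualNr !dualZr /refl !dualB !dualZ !pairingE //.
rewrite (tau_sym G a c); field.
exact: n0.
Qed.

Lemma refl_pairing a b c : is_root a -> is_root c ->
  refl a b (coroot (refl a c)) = b (coroot c) :> K.
Proof.
move=> ar cr; rewrite !pairingE //; last exact: refl_root.
by rewrite !refl_isometry.
Qed.

Section Base.
Context (J : finType) (B : J -> dual h).
Hypothesis Bb : root_base B.

Lemma base_coef_inj (m n : J -> int) :
  \sum_j B j *~ m j = \sum_j B j *~ n j -> m =1 n.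
Proof.
have [_ /free_familyP fB _] := Bb.
move=> /eqP; rewrite -subr_eq0 -sumrB => /eqP e j.
apply: (@intr_inj K); apply/eqP; rewrite -subr_eq0; apply/eqP.
move: j; apply: fB; rewrite -[RHS]e; apply: eq_bigr => j _.
by rewrite scalerBl !scaler_int.
Qed.

Lemma base_coef_injn (m n : J -> nat) :
  \sum_j B j *+ m j = \sum_j B j *+ n j -> m =1 n.
Proof.
move=> e j; have := @base_coef_inj (fun j => m j) (fun j => n j).
move=> /(_ _ j) mn; apply/eqP; rewrite -eqz_nat; apply/eqP/mn; exact: e.
Qed.

Lemma base_delta j : B j = \sum_i B i *+ (i == j).
Proof.
rewrite (bigD1 j) //= eqxx big1 ?addr0 // => i /negPf ->; exact: mulr0n.
Qed.

Lemma ncone_opp a : is_root a -> ncone B a -> ncone B (- a) -> False.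
Proof.
move=> [a0 _] [m am] [n an]; apply: a0; rewrite am big1 // => j _.
suff -> : m j = 0%N by rewrite mulr0n.
have := @base_coef_injn (fun j => m j + n j)%N (fun _ => 0%N).
move=> /(_ _ j) /= H; suff : (m j + n j = 0)%N by lia.
apply: H; rewrite [RHS]big1 // -[RHS](subrr a) {1}am an -big_split /=.
by apply: eq_bigr => i _; rewrite mulrnDr.
Qed.

Lemma base_root_cases a : is_root a -> ncone B a \/ ncone B (- a).
Proof. by have [_ _] := Bb; apply. Qed.

Lemma ncone_neg a (n : J -> int) j : is_root a -> a = \sum_j B j *~ n j ->
  0 < n j -> ncone B a.
Proof.
move=> ar an nj; have [//|[m am]] := base_root_cases ar.
have := @base_coef_inj n (fun j => - (m j : int)).
move=> /(_ _ j) H; suff : n j = - (m j : int) by lia.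
apply: H; rewrite -an -[LHS]opprK am -sumrN; apply: eq_bigr => i _.
by rewrite mulrNz.
Qed.

(** The root system being reduced, [a] involves a simple root other than [B j]. Its coefficient is
    unchanged by the reflection, and one positive coefficient decides the sign of a root. *)
Lemma simple_refl_ncone j a : is_root a -> ncone B a -> a <> B j ->
  ncone B (refl (B j) a).
Proof.
move=> ar [n an] aB; have [Br _ _] := Bb.
have [i ij ni] : exists2 i, i != j & (0 < n i)%N.
  apply: contrapT => H; apply: aB.
  have ae : a = B j *+ n j.
    rewrite an (bigD1 j) //= big1 ?addr0 // => i ij.
    case E : (n i) => [|k]; first by rewrite mulr0n.
    by case: H; exists i; rewrite ?E.
  by move: (ar); rewrite ae => /(reduced G (Br j)) ->; rewrite mulr1n.
have [m /reflE rE rr] := pairing_int G (Br j) ar; rewrite -rE in rr.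
apply: (@ncone_neg _ (fun k => (n k : int) - m *~ (k == j)) i) => //; last first.
  by rewrite (negPf ij) mulr0z subr0.
rewrite rE an (bigD1 j) //= [RHS](bigD1 j) //= eqxx addrAC; congr (_ + _).
  by rewrite mulr1z mulrzBr.
by apply: eq_bigr => k /negPf ->; rewrite mulr0z subr0.
Qed.

End Base.

Lemma refl_base (J : finType) (B : J -> dual h) a :
  is_root a -> root_base B -> root_base (fun j => refl a (B j)).
Proof.
move=> ar [Br /free_familyP Bf Bc]; split=> [j||b br].
- exact: refl_root.
- apply/free_familyP => k k0; apply: Bf; apply: (can_inj (reflK ar)).
  rewrite linear0 -[RHS]k0 linear_sum; apply: eq_bigr => j _.
  by rewrite linearZ.
have nc c : ncone B c -> ncone (fun j => refl a (B j)) (refl a c).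
  move=> [n ->]; exists n; rewrite linear_sum; apply: eq_bigr => j _.
  by rewrite raddfMn.
have [] := Bc _ (refl_root ar br) => /nc.
  by rewrite (reflK ar); left.
by rewrite linearN /= (reflK ar); right.
Qed.

Lemma ncone_trans (J J' : finType) (A : J -> dual h) (B : J' -> dual h) a :
  (forall j, ncone A (B j)) -> ncone B a -> ncone A a.
Proof.
move=> BA [n ->]; have [m mP] := fin_all_exists BA.
exists (fun k => \sum_j m j k * n j)%N.
under eq_bigr do rewrite mP -sumrMnl.
rewrite exchange_big; apply: eq_bigr => k _ /=.
by under eq_bigr do rewrite -mulrnA; rewrite sumrMnr.
Qed.

(** Expand [A i] along [B], then each [B j] along [A]: the product of these matrices of natural
    numbers is the identity. So a [B j] occurring in [A i] is a multiple of [A i], and equals it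
    because the system is reduced. *)
Lemma base_subset (J J' : finType) (A : J -> dual h) (B : J' -> dual h) :
  root_base A -> root_base B -> (forall j, ncone A (B j)) ->
  forall i, exists j, B j = A i.
Proof.
move=> Ab Bb BA i; have [Ar _ _] := Ab; have [Br _ _] := Bb.
have Ai : ncone A (A i) by exists (fun k => k == i : nat); apply: base_delta.
have [[n nE]|nA] := base_root_cases Bb (Ar i); last first.
  by case: (ncone_opp Ab (Ar i) Ai (ncone_trans BA nA)).
have [m mP] := fin_all_exists BA.
have coef k : (\sum_j m j k * n j)%N = (k == i).
  apply: (@base_coef_injn _ _ Ab (fun k => \sum_j m j k * n j)%N
    (fun k => k == i : nat)); rewrite -base_delta nE.
  under [RHS]eq_bigr do rewrite mP -sumrMnl.
  rewrite [RHS]exchange_big; apply: eq_bigr => l _ /=.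
  by under [RHS]eq_bigr do rewrite -mulrnA; rewrite sumrMnr.
have [j mj] : exists j, (0 < m j i * n j)%N.
  apply: contrapT => /forallNP H; have := coef i.
  by rewrite eqxx big1 // => j _; case: (_ * _)%N (H j).
exists j; have jE : B j = A i *+ m j i.
  rewrite mP (bigD1 i) //= big1 ?addr0 // => k /negPf ki.
  suff -> : m j k = 0%N by rewrite mulr0n.
  have /eqP := coef k; rewrite ki sum_nat_eq0 => /forallP/(_ j) /=.
  by move: mj; case: (n j) => [|N]; rewrite ?muln0 // muln_eq0 orbF => _ /eqP.
by move: (Br j); rewrite jE => /(reduced G (Ar i)) ->; rewrite mulr1n.
Qed.

Lemma base_inj (J : finType) (A : J -> dual h) : root_base A -> injective A.
Proof.
move=> Ab i j; rewrite (base_delta A i) (base_delta A j) => /(base_coef_injn Ab)/(_ i).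
by rewrite eqxx; case: eqP.
Qed.

Lemma count_ltn (T : eqType) (p q : pred T) (s : seq T) x :
  {in s, subpred p q} -> x \in s -> q x -> ~~ p x -> (count p s < count q s)%N.
Proof.
elim: s => //= y s IH pq; rewrite inE => /predU1P[->|xs] qx px.
  rewrite qx (negPf px) add0n add1n ltnS.
  have -> : count p s = count (predI (mem s) p) s by apply: eq_in_count => z /= ->.
  by apply: sub_count => z /andP[zs]; apply: pq; rewrite inE [z \in s]zs orbT.
have pqs : {in s, subpred p q} by move=> z zs; apply: pq; rewrite inE zs orbT.
rewrite -addnS leq_add ?IH //.
by have := pq y (mem_head _ _); case: (p y) => // /(_ isT) ->.
Qed.

(* Induction on the number of A-positive B-negative roots, which drops when B is
   reflected in one of its A-negative members. *)
Lemma base_conjugate (J J' : finType) (A : J -> dual h) (B : J' -> dual h) :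
  root_base A -> root_base B -> exists2 f : J' -> J, bijective f &
  forall i j, B j (coroot (B i)) = A (f j) (coroot (A (f i))) :> K.
Proof.
move=> Ab; have [s sP] := finite_roots G.
pose bad (B : J' -> dual h) c := `[< [/\ is_root c, ncone A c & ncone B (- c)] >].
have [n] := ubnP (count (bad B) s); elim: n B => // n IH B badn Bb.
have [Br Bf Bc] := Bb.
have [BA|/existsNP[j jA]] := pselect (forall j, ncone A (B j)).
  have AB := base_subset Ab Bb BA; have [g' g'P] := fin_all_exists AB.
  have BA' : forall i, ncone B (A i).
    by move=> i; rewrite -g'P; exists (fun k => k == g' i : nat); apply: base_delta.
  have [f fP] := fin_all_exists (base_subset Bb Ab BA').
  exists f => [|i j]; last by rewrite !fP.
  exists g' => i; [apply: (base_inj Bb)|apply: (base_inj Ab)];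
    by rewrite ?g'P ?fP ?g'P.
have BjA : ncone A (- B j) by have [] := base_root_cases Ab (Br j).
have BjB : ncone B (B j) by exists (fun k => k == j : nat); apply: base_delta.
have badj : bad B (- B j).
  by apply/asboolP; rewrite opprK; split=> //; apply: (rootN G).
pose B' i := refl (B j) (B i).
have B'b : root_base B' by apply: refl_base.
have [|f fb fP] := IH B' _ B'b; last first.
  by exists f => // i k; rewrite -fP refl_pairing.
rewrite -ltnS; apply: leq_trans badn; rewrite ltnS; apply: (@count_ltn _ _ _ _ (- B j)) => //.
(* The reflection preserves [B]-positivity except at [B j], and [B j] is [A]-negative; so a root bad
   for [B'] was already bad for [B]. *)
- move=> c _ /asboolP[cr cA cB'].
  have cB : ncone B (refl (B j) (- c)).
    have [n' e] := cB'; exists n'; rewrite e linear_sum; apply: eq_bigr => i _.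
    by rewrite raddfMn /= /B' reflK.
  have rr : is_root (refl (B j) (- c)) by apply: refl_root => //; apply: (rootN G).
  apply/asboolP; split => //; rewrite -[- c](reflK (Br j)).
  apply: simple_refl_ncone => // e.
  have cE : c = B j.
    apply: oppr_inj; apply: (can_inj (reflK (Br j))); rewrite e linearN /= refl_self //.
    by rewrite opprK.
  by apply: (ncone_opp Ab cr cA); rewrite cE.
- exact/sP/(rootN G).
apply/negP => /asboolP[_ _]; rewrite opprK => -[n' e].
apply: (ncone_opp Bb (Br j) BjB); rewrite -refl_self //; exists n'.
rewrite {2}e linear_sum; apply: eq_bigr => i _.
by rewrite raddfMn /= /B' reflK.
Qed.
End RootBases.

(* Adding [k] at [i] is the [i]-th simple reflection, the sum being the value of the
   [i]-th simple coroot on the root with coefficients [x]. *)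
Inductive ascending (r : nat) (C : nat -> nat -> int) : (nat -> int) -> Prop :=
| ascending_simple i : (i < r)%N -> ascending r C (fun j => (j == i)%:Z)
| ascending_step x i k : ascending r C x -> (i < r)%N -> 0 < k ->
    \sum_(l < r) C i l * x l = - k ->
    ascending r C (fun j => x j + (j == i)%:Z * k).

(** * Induction on positive roots by simple reflections *)

Section RootInduction.
Context (K : numFieldType) (g : finLieAlgType K) (h : {vspace g}).
Context (tau : 'Hom(dual h, subvs_of h)).
Hypothesis G : root_geometry tau.
Context (J : finType) (B : J -> dual h).
Hypothesis Bb : root_base B.
Implicit Types (a b : dual h) (c : J -> nat).

Local Notation comb c := (\sum_j B j *+ c j).

Lemma dual_sum (I : finType) (F : I -> dual h) u :
  (\sum_i F i) u = \sum_i (F i u : K) :> K.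
Proof. by rewrite sum_lfunE. Qed.

(** The norm of the root is positive and equals the sum over [j] of [c j] times the form of [B j]
    with the root, so some term is positive. *)
Lemma root_descent c : is_root (comb c) -> exists j,
  (0 < c j)%N /\ exists2 m : nat, (0 < m)%N & comb c (coroot (B j)) = m%:R :> K.
Proof.
move=> cr; have [Br _ _] := Bb.
have/fin_all_exists [p pP] j : exists m : int, comb c (coroot (B j)) = m%:~R :> K.
  by have [m] := pairing_int G (Br j) cr; exists m.
apply: contrapT => H.
suff N0 : (comb c (tau (comb c)) : K) <= 0 by move: N0; rewrite (lt_geF (norm_gt0 G cr)).
rewrite {1}dual_sum; apply: sumr_le0 => j _; rewrite dualMn.
have [->|cj] := posnP (c j); first by rewrite mulr0n.
apply: mulrn_wle0; rewrite (tau_sym G).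
have pj : p j <= 0.
  rewrite leNgt; apply/negP; case: (p j) (pP j) => // m pm m0; apply: H.
  by exists j; split => //; exists m.
have := pP j; rewrite (pairingE G) // => /(canRL (divfK (norm_neq0 G (Br j)))) e.
have -> : comb c (tau (B j)) = (p j)%:~R * B j (tau (B j)) / 2%:R :> K.
  by rewrite -e mulrC mulKf ?pnatr_eq0.
rewrite -mulrA mulr_le0_ge0 ?lerz0 // divr_ge0 ?ler0n // ltW //.
exact: (norm_gt0 G).
Qed.

Lemma comb_add c j k : comb (fun i => c i + (i == j) * k)%N = comb c + B j *+ k.
Proof.
under eq_bigr do rewrite mulrnDr; rewrite big_split /=; congr (_ + _).
rewrite (bigD1 j) //= eqxx mul1n big1 ?addr0 // => i /negPf ->; exact: mulr0n.
Qed.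

(** Reflecting in the simple root found by [root_descent] lowers the height and keeps the root
    positive. *)
Lemma base_root_ind (P : (J -> nat) -> Prop) :
  (forall j, P (fun i => (i == j) : nat)) ->
  (forall c j k, is_root (comb c) -> P c -> (0 < k)%N ->
     comb c (coroot (B j)) = - k%:R :> K -> P (fun i => c i + (i == j) * k)%N) ->
  forall c, is_root (comb c) -> P c.
Proof.
move=> P1 PS c; have [n] := ubnP (\sum_j c j)%N; elim: n c => // n IH c cn cr.
have [Br _ _] := Bb.
have [[j cj]|cS] := pselect (exists j, comb c = B j).
  suff -> : c = (fun i => (i == j) : nat) by [].
  by apply/funext; apply: (base_coef_injn Bb); rewrite cj -base_delta.
have [j [cj [m m0 cm]]] := root_descent cr.
have cB : comb c <> B j by move=> e; apply: cS; exists j.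
have : ncone B (refl (B j) (comb c)).
  by apply: (simple_refl_ncone G Bb) => //; exists c.
have rE : refl (B j) (comb c) = comb c - B j *+ m by rewrite /refl cm scaler_nat.
move=> [c' c'E].
have cE : c = (fun i => c' i + (i == j) * m)%N.
  by apply/funext; apply: (base_coef_injn Bb); rewrite comb_add -c'E rE subrK.
have c'r : is_root (comb c') by rewrite -c'E; apply: (refl_root G).
rewrite cE; apply: PS => //.
  apply: IH => //; move: cn; rewrite cE big_split /=.
  by rewrite [X in (_ + X)%N](bigD1 j) //= eqxx; lia.
rewrite -c'E rE dualB dualMn cm (pairing_self G) // -mulr_natr.
ring.
Qed.

(** The node added by an ascent has nonzero pairing with the root, hence with some node of the
    support, so it falls on the same side of [p]. *)
Lemma root_support_connected c (p : pred J) : is_root (comb c) ->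
  (forall i j, (0 < c i)%N -> (0 < c j)%N -> p i -> ~~ p j -> B i (coroot (B j)) = 0 :> K) ->
  (forall i j, (0 < c i)%N -> (0 < c j)%N -> p i -> ~~ p j -> B j (coroot (B i)) = 0 :> K) ->
  (forall j, (0 < c j)%N -> p j) \/ (forall j, (0 < c j)%N -> ~~ p j).
Proof.
move=> cr; move: c cr; apply: base_root_ind => [i|c j k _ IH k0 ck] orth1 orth2.
  by case pi : (p i); [left|right] => j; case: eqP => // ->; rewrite pi.
have sub i : (0 < c i -> 0 < c i + (i == j) * k)%N by lia.
have cj : (0 < c j + (j == j) * k)%N by rewrite eqxx; lia.
have c0 : (exists i, (0 < c i)%N /\ B i (coroot (B j)) <> 0 :> K).
  apply: contrapT => /forallNP H; move: ck; rewrite dual_sum big1.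
    by move/eqP; rewrite eq_sym oppr_eq0 pnatr_eq0; case: (k) k0.
  move=> i _; rewrite dualMn; have [->|ci] := posnP (c i); first by rewrite mulr0n.
  have /not_andP[//|/contrapT ->] := H i; exact: mul0rn.
have [i [ci Bij]] := c0.
have [||cp|cp] := IH.
- by move=> a b ca cb; apply: orth1; apply: sub.
- by move=> a b ca cb; apply: orth2; apply: sub.
- left => l; case: (altP (l =P j)) => [->|lj]; last by rewrite mul0n addn0; apply: cp.
  move=> _; apply/negPn/negP => pj; apply: Bij.
  by apply: orth1 => //; [apply: sub|apply: cp].
right => l; case: (altP (l =P j)) => [->|lj]; last by rewrite mul0n addn0; apply: cp.
move=> _; apply/negP => pj; apply: Bij.
by apply: orth2 => //; [apply: sub|apply: cp].
Qed.

(** Renumbering the simple roots along [s] leaves a problem about integers and the Cartan matrix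
    alone. *)
Lemma root_ascending (r : nat) (C : nat -> nat -> int) (s : J -> 'I_r) c :
  bijective s -> (forall i j, B j (coroot (B i)) = (C (s i) (s j))%:~R :> K) ->
  is_root (comb c) ->
  ascending r C (fun k => \sum_j (k == s j)%:Z * (c j)%:Z).
Proof.
move=> sb BC; move: c; apply: base_root_ind => [i|c j k cr IH k0 ck].
  have -> : (fun k : nat => \sum_j (k == s j)%:Z * (j == i)%:Z) = (fun k => (k == s i)%:Z).
    apply/funext => k; rewrite (bigD1 i) //= eqxx mulr1 big1 ?addr0 //.
    by move=> j /negPf ->; rewrite mulr0.
  exact: ascending_simple.
have -> : (fun l : nat => \sum_i (l == s i)%:Z * (c i + (i == j) * k)%N%:Z) =
    (fun l => (\sum_i (l == s i)%:Z * (c i)%:Z) + (l == s j)%:Z * k%:Z).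
  apply/funext => l; under eq_bigr do rewrite PoszD mulrDr.
  rewrite big_split /=; congr (_ + _); rewrite (bigD1 j) //= eqxx mul1n big1 ?addr0 //.
  by move=> i /negPf ->; rewrite mul0n mulr0.
apply: ascending_step => //.
rewrite (reindex s) /=; last exact: onW_bij.
apply: (@intr_inj K); rewrite rmorphN /= -[k%:~R]/(k%:R) -ck dual_sum rmorph_sum /=.
apply: eq_bigr => i _; rewrite dualMn BC rmorphM /= -mulr_natr; congr (_ * _).
rewrite (bigD1 i) //= eqxx mul1r big1 ?addr0 // => l /negPf li.
have -> : (s i == s l :> nat) = false.
  by apply/negbTE/eqP => /val_inj/(bij_inj sb) e; rewrite e eqxx in li.
by rewrite mul0r.
Qed.
End RootInduction.

(** * Coefficients of positive roots *)

Section AscendingBasics.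
Context (r : nat) (C : nat -> nat -> int).

Lemma ascending_ge0 x : ascending r C x -> forall k, 0 <= x k.
Proof.
elim=> [i _|{}x i k _ x0 _ k0 _] j; first by case: (j =P i).
by have := x0 j; case: (j =P i); lia.
Qed.

Lemma ascending_supp x : ascending r C x -> forall k, (r <= k)%N -> x k = 0.
Proof.
elim=> [i ir|{}x i k _ IH ir _ _] j jr; first by case: (j =P i) => // ji; lia.
by rewrite IH //; case: (j =P i) => [|_]; [lia|rewrite mul0r].
Qed.

(* What connectivity of the diagram on the nodes below the top node [i] says about
   the support of [x]. *)
Definition uncut (x : nat -> int) (i : nat) := forall S : pred nat,
  (forall k l, (k < r)%N -> (l < r)%N -> S k -> ~~ S l -> k != i -> l != i ->
     C k l = 0 /\ C l k = 0) ->
  (forall k, k != i -> S k -> x k = 0) \/ (forall k, k != i -> ~~ S k -> x k = 0).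

Lemma sum_support (F : nat -> int) (s : seq nat) : uniq s ->
  (forall l, (l < r)%N -> l \notin s -> F l = 0) ->
  (forall l, l \in s -> (r <= l)%N -> F l = 0) ->
  \sum_(l < r) F l = \sum_(l <- s) F l.
Proof.
move=> us F0 Fr; rewrite -(big_mkord xpredT F) /index_iota subn0.
rewrite (bigID (mem s)) /= [X in _ + X]big_seq_cond [X in _ + X]big1 ?addr0; last first.
  by move=> l /andP[]; rewrite mem_iota; apply: F0.
rewrite [RHS](bigID (fun l => l < r)%N) /= [X in _ = _ + X]big_seq_cond.
rewrite [X in _ = _ + X]big1 ?addr0; last first.
  by move=> l /andP[ls]; rewrite -leqNgt; apply: Fr.
rewrite -big_filter -[RHS]big_filter; apply: perm_big; apply: uniq_perm.
- exact/filter_uniq/iota_uniq.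
- exact: filter_uniq.
by move=> l; rewrite !mem_filter mem_iota add0n leq0n andTb andbC.
Qed.
End AscendingBasics.

(* In types A, B, C, D the coefficients of a root, corrected at the last nodes in
   types C and D (see [epsC] and [epsD]), are the partial sums of its coordinates
   in the standard basis; [eps] recovers these coordinates. *)
Definition eps (y : nat -> int) (k : nat) : int :=
  y k - (if k is j.+1 then y j else 0).

Lemma eps_partial_sum y j : `|y j| <= \sum_(k < j.+1) `|eps y k|.
Proof.
elim: j => [|j IH]; first by rewrite big_ord1 /eps subr0.
rewrite big_ord_recr /= -[y j.+1](subrK (y j)).
by apply: le_trans (ler_normD _ _) _; rewrite [leLHS]addrC; apply: lerD.
Qed.

Lemma eps_sum_le2 y j n : (j < n)%N -> \sum_(k < n) `|eps y k| <= 2 -> `|y j| <= 2.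
Proof.
move=> jn; apply: le_trans; apply: le_trans (eps_partial_sum y j) _.
rewrite -!(big_mkord xpredT (fun k => `|eps y k|)) [leRHS](big_cat_nat (n := j.+1)) //=.
by rewrite lerDl sumr_ge0.
Qed.

Lemma abs_sum_split (f : nat -> int) n i : (i.+1 < n)%N ->
  \sum_(k < n) `|f k| = `|f i| + `|f i.+1| +
    \sum_(k < n | (k != i :> nat) && (k != i.+1 :> nat)) `|f k|.
Proof.
move=> iN; have iN' : (i < n)%N by lia.
rewrite (bigD1 (Ordinal iN')) //= (bigD1 (Ordinal iN)) /=; last first.
  by rewrite -val_eqE /=; lia.
by rewrite addrA; congr (_ + _).
Qed.

Lemma abs_sum_swap (e e' : nat -> int) n i : (i.+1 < n)%N ->
  (forall k, k != i -> k != i.+1 -> e' k = e k) ->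
  `|e' i| + `|e' i.+1| = `|e i| + `|e i.+1| ->
  \sum_(k < n) `|e' k| = \sum_(k < n) `|e k|.
Proof.
move=> iN ee ei; rewrite !(abs_sum_split _ iN) ei; congr (_ + _).
by apply: eq_bigr => k /andP[? ?]; rewrite ee.
Qed.

Lemma abs_sum_two (e : nat -> int) n i :
  (forall k, k != i -> k != i.+1 -> e k = 0) ->
  \sum_(k < n) `|e k| <= `|e i| + `|e i.+1|.
Proof.
move=> e0; apply: (@le_trans _ _ (\sum_(k < n + i.+2) `|e k|)).
  rewrite -!(big_mkord xpredT (fun k => `|e k|)) [leRHS](big_cat_nat (n := n)) //=.
    by rewrite lerDl sumr_ge0.
  exact: leq_addr.
rewrite (abs_sum_split _ (i := i)); last by lia.
by rewrite [X in _ + X]big1 ?addr0 // => k /andP[? ?]; rewrite e0.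
Qed.

Ltac cases_lia := repeat match goal with |- context [if ?b then _ else _] =>
  case: (boolP b) => ?; try (exfalso; lia) end; try lia.

Lemma laced_diag adj i : laced adj i i = 2.
Proof. by rewrite /laced eqxx. Qed.
Lemma laced_succ i : laced path_adj i i.+1 = -1.
Proof. by rewrite /laced /path_adj eqxx; case: eqP => //; lia. Qed.
Lemma laced_pred i : laced path_adj i.+1 i = -1.
Proof. by rewrite /laced /path_adj eqxx orbT; case: eqP => //; lia. Qed.
Lemma laced_far i j : j != i -> j != i.+1 -> j.+1 != i -> laced path_adj i j = 0.
Proof. by rewrite /laced /path_adj => *; cases_lia. Qed.


Lemma path_row r (C : nat -> nat -> int) x i : (i < r)%N -> (forall k, (r <= k)%N -> x k = 0) ->
  (forall l, (l < r)%N -> l != i -> l != i.+1 -> l.+1 != i -> C i l = 0) ->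
  \sum_(l < r) C i l * x l =
  C i i * x i + C i i.+1 * x i.+1 + (if i is j.+1 then C i j * x j else 0).
Proof.
move=> ir xr C0; rewrite (@sum_support r (fun l => C i l * x l)
  (if i is j.+1 then [:: j; i; i.+1] else [:: i; i.+1])).
- by case: i ir {C0} => [|i] ir; rewrite !big_cons big_nil; lia.
- by case: i ir {C0} => [|i] ir; rewrite /= ?inE; lia.
- move=> l lr; case: i ir C0 => [|i] ir C0; rewrite !inE !negb_or => H.
    by rewrite C0 ?mul0r //; lia.
  by rewrite C0 ?mul0r //; lia.
by move=> l _ /xr ->; rewrite mulr0.
Qed.

Definition stepped (x : nat -> int) i k : nat -> int := fun j => x j + (j == i)%:Z * k.

Lemma steppedE x i k j : stepped x i k j = if j == i then x i + k else x j.
Proof. by rewrite /stepped; case: eqP => [->|_]; lia. Qed.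


Lemma stepped_eps x i k l : l != i -> l != i.+1 -> eps (stepped x i k) l = eps x l.
Proof. by case: l => [|l] l1 l2; rewrite /eps !steppedE; cases_lia. Qed.

Lemma stepped_eps0 x i k : eps (stepped x i k) i = eps x i + k.
Proof. by case: i => [|i]; rewrite /eps !steppedE; cases_lia. Qed.

Lemma stepped_eps1 x i k : eps (stepped x i k) i.+1 = eps x i.+1 - k.
Proof. by rewrite /eps !steppedE; cases_lia. Qed.

Lemma unit_eps_le2 n i : \sum_(k < n) `|eps (fun j => (j == i)%:Z) k| <= 2.
Proof.
apply: le_trans (@abs_sum_two _ _ i _) _; last by rewrite /eps; case: i => [|j]; lia.
by case=> [|l]; rewrite /eps; lia.
Qed.

(** * Classical types, by coordinates in the standard basis *)

Lemma rowA n x i : (i < n)%N -> (forall k, (n <= k)%N -> x k = 0) ->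
  \sum_(l < n) cartan_entry (TypeA n) i l * x l = eps x i - eps x i.+1.
Proof.
move=> ir xr; rewrite path_row //= => [|l lr l1 l2 l3]; last by rewrite laced_far.
rewrite laced_diag laced_succ.
by case: i ir => [|i] ir; rewrite /eps ?laced_pred; lia.
Qed.

(** The [n.+1] coordinates add up to 0 because [x n = 0]. Those up to [i] and those after [i] each
    contribute at least the absolute value of [x i] to a total of at most 2. *)
Lemma ascendingA_le1 n x i : ascending n (cartan_entry (TypeA n)) x -> x i <= 1.
Proof.
move=> xa; suff V : \sum_(k < n.+1) `|eps x k| <= 2.
  have [ni|ni] := leqP n i; first by rewrite (ascending_supp xa).
  have : `|x i| <= \sum_(i.+1 <= k < n.+1) `|eps x k|.
    have H m : (i.+1 <= m)%N -> `|x i| - `|x m.-1| <= \sum_(i.+1 <= k < m) `|eps x k|.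
      elim: m => // m IH; rewrite leq_eqVlt => /predU1P[[<-]|im].
        by rewrite subrr sumr_ge0.
      rewrite big_nat_recr //=; have := IH im.
      have -> : eps x m = x m - x m.-1 by case: m im {IH}.
      by move: (\sum_(i.+1 <= k < m) _) => S; lia.
    by have := H n.+1; rewrite /= [x n](ascending_supp xa) // normr0 subr0; apply; lia.
  have := eps_partial_sum x i; move: V.
  rewrite -!(big_mkord xpredT (fun k => `|eps x k|)) (big_cat_nat (n := i.+1)) //=; last by lia.
  by move: (\sum_(0 <= k < i.+1) _) (\sum_(i.+1 <= k < n.+1) _) => S S'; lia.
elim: xa => [{x}i' ir|{}x i' k xa IH ir k0 kE]; first exact: unit_eps_le2.
apply: le_trans IH; rewrite le_eqVlt; apply/orP; left; apply/eqP.
move: kE; rewrite rowA //; last exact: ascending_supp xa.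
(* In coordinates, the reflection swaps the entries [i'] and [i'.+1]. *)
rewrite -/(stepped x i' k) => kE; apply: (@abs_sum_swap _ _ _ i') => //.
  by move=> l; apply: stepped_eps.
by rewrite stepped_eps0 stepped_eps1; lia.
Qed.

Lemma rowB n x i : (2 <= n)%N -> (i < n)%N -> (forall k, (n <= k)%N -> x k = 0) ->
  \sum_(l < n) cartan_entry (TypeB n) i l * x l =
  if i == n.-1 then 2 * eps x i else eps x i - eps x i.+1.
Proof.
move=> n2 ir xr; rewrite path_row //= => [|l lr l1 l2 l3]; last first.
  by rewrite laced_far //; case: ifP; lia.
rewrite laced_diag laced_succ ifF; last by lia.
rewrite ifF; last by lia.
case: i ir => [|i] ir; rewrite /eps ?laced_pred; case: ifP => e; try lia.
  by rewrite (xr i.+2) ?ifT; lia.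
by rewrite ifF; lia.
Qed.

Lemma ascendingB_eps n x : (2 <= n)%N -> ascending n (cartan_entry (TypeB n)) x ->
  \sum_(k < n) `|eps x k| <= 2.
Proof.
move=> n2; elim=> [{x}i ir|{}x i k xa IH ir k0 kE]; first exact: unit_eps_le2.
apply: le_trans IH; rewrite le_eqVlt; apply/orP; left; apply/eqP.
rewrite -/(stepped x i k); have xr := ascending_supp xa.
(* The last reflection changes the sign of the last coordinate; the others swap neighbours. *)
move: kE; rewrite rowB //; case: ifP => ei kE.
  apply: eq_bigr => l _; have [->|li] := eqVneq (l : nat) i.
    by rewrite stepped_eps0; lia.
  by rewrite stepped_eps //; move: (ltn_ord l); lia.
apply: (@abs_sum_swap _ _ _ i); first by lia.
  by move=> l; apply: stepped_eps.
by rewrite stepped_eps0 stepped_eps1; lia.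
Qed.

(** The last simple root of type C is twice a basis vector, hence the factor 2. *)
Definition epsC n (x : nat -> int) k := if k == n.-1 then 2 * x k else x k.

Lemma rowC n x i : (2 <= n)%N -> (i < n)%N -> (forall k, (n <= k)%N -> x k = 0) ->
  \sum_(l < n) cartan_entry (TypeC n) i l * x l =
  if i == n.-1 then eps (epsC n x) i else eps (epsC n x) i - eps (epsC n x) i.+1.
Proof.
move=> n2 ir xr; rewrite path_row //= => [|l lr l1 l2 l3]; last first.
  by rewrite laced_far //; case: ifP; lia.
rewrite laced_diag laced_succ ifF; last by lia.
case: i ir => [|i] ir; rewrite /eps /epsC ?laced_pred.
  by cases_lia.
have [e|e] := eqVneq i.+1 n.-1; first by rewrite (xr i.+2); [cases_lia|lia].
by cases_lia.
Qed.

Lemma epsC_stepped n x i k : (i < n)%N ->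
  epsC n (stepped x i k) = stepped (epsC n x) i (if i == n.-1 then 2 * k else k).
Proof.
by move=> ir; apply/funext => j; rewrite /epsC !steppedE /epsC; cases_lia.
Qed.

Lemma ascendingC_eps n x : (2 <= n)%N -> ascending n (cartan_entry (TypeC n)) x ->
  \sum_(k < n) `|eps (epsC n x) k| <= 2.
Proof.
move=> n2; elim=> [{x}i ir|{}x i k xa IH ir k0 kE].
  have [ei|ei] := eqVneq i n.-1; last first.
    rewrite (_ : epsC _ _ = (fun j => (j == i)%:Z)); first exact: unit_eps_le2.
    by apply/funext => j; rewrite /epsC; case: ifP; lia.
  rewrite (bigD1 (Ordinal ir)) //= big1 => [|l li].
    by rewrite /eps /epsC; case: i {ir} ei => [|j]; cases_lia.
  have {li} : l != i :> nat by rewrite -val_eqE in li.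
  by rewrite /eps /epsC; case: (nat_of_ord l) (ltn_ord l) => [|m]; cases_lia.
apply: le_trans IH; rewrite le_eqVlt; apply/orP; left; apply/eqP.
rewrite -/(stepped x i k) epsC_stepped //; have xr := ascending_supp xa.
move: kE; rewrite rowC //; case: ifP => ei kE.
  apply: eq_bigr => l _; have [->|li] := eqVneq (l : nat) i.
    by rewrite stepped_eps0; lia.
  by rewrite stepped_eps //; move: (ltn_ord l); lia.
apply: (@abs_sum_swap _ _ _ i); first by lia.
  by move=> l; apply: stepped_eps.
by rewrite stepped_eps0 stepped_eps1; lia.
Qed.

(** The last two simple roots of type D are the difference and the sum of the last two basis
    vectors: each adds 1 to the partial sum at [n.-2], and they add 0 and 2 to the one at [n.-1]. *)
Definition epsD n (x : nat -> int) k :=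
  if k == n.-1 then 2 * x k else if k == n.-2 then x k + x k.+1 else x k.

Lemma D_adjE n i j : D_adj n i j =
  ((j == n.-1) && (i == n - 3)%N) || ((j != n.-1) && (j == i.+1)).
Proof. by rewrite /D_adj; case: (j == n.-1); rewrite ?orbF. Qed.

Lemma rowD n x i : (4 <= n)%N -> (i < n)%N -> (forall k, (n <= k)%N -> x k = 0) ->
  \sum_(l < n) cartan_entry (TypeD n) i l * x l =
  if i == n.-1 then eps (epsD n x) n.-2 + eps (epsD n x) n.-1
  else eps (epsD n x) i - eps (epsD n x) i.+1.
Proof.
case: n => [|[|[|[|m]]]] // _ ir xr.
have [im|im] := leqP i m.
  rewrite path_row // => [|l lr l1 l2 l3]; last first.
    by rewrite /= /laced !D_adjE; cases_lia.
  rewrite ifF; last by lia.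
  rewrite /= /laced !D_adjE /eps /epsD.
  by case: i ir im => [|i] ir im; rewrite ?D_adjE; cases_lia.
have [->|[->|->]] : i = m.+1 \/ i = m.+2 \/ i = m.+3 by lia.
- rewrite (@sum_support _ (fun l => cartan_entry (TypeD m.+4) m.+1 l * x l)
    [:: m; m.+1; m.+2; m.+3]).
  + rewrite !big_cons big_nil /= /laced !D_adjE /eps /epsD /=; cases_lia.
  + by rewrite /= !inE; lia.
  + move=> l lr; rewrite !inE !negb_or => H.
    have -> : cartan_entry (TypeD m.+4) m.+1 l = 0 by rewrite /= /laced !D_adjE; cases_lia.
    by rewrite mul0r.
  by move=> l _ /xr ->; rewrite mulr0.
- rewrite (@sum_support _ (fun l => cartan_entry (TypeD m.+4) m.+2 l * x l)
    [:: m.+1; m.+2]).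
  + rewrite !big_cons big_nil /= /laced !D_adjE /eps /epsD /=; cases_lia.
  + by rewrite /= !inE; lia.
  + move=> l lr; rewrite !inE !negb_or => H.
    have -> : cartan_entry (TypeD m.+4) m.+2 l = 0 by rewrite /= /laced !D_adjE; cases_lia.
    by rewrite mul0r.
  by move=> l _ /xr ->; rewrite mulr0.
rewrite (@sum_support _ (fun l => cartan_entry (TypeD m.+4) m.+3 l * x l)
    [:: m.+1; m.+3]).
+ rewrite !big_cons big_nil /= /laced !D_adjE /eps /epsD /=; cases_lia.
+ by rewrite /= !inE; lia.
+ move=> l lr; rewrite !inE !negb_or => H.
  have -> : cartan_entry (TypeD m.+4) m.+3 l = 0 by rewrite /= /laced !D_adjE; cases_lia.
  by rewrite mul0r.
by move=> l _ /xr ->; rewrite mulr0.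
Qed.

Lemma epsD_stepped n x i k : (4 <= n)%N -> (i < n.-1)%N ->
  epsD n (stepped x i k) = stepped (epsD n x) i k.
Proof.
move=> n4 ir; apply/funext => j; have [->|ji] := eqVneq j i;
  by rewrite /epsD !steppedE /epsD; cases_lia.
Qed.

Lemma epsD_stepped_last n x k : (4 <= n)%N ->
  epsD n (stepped x n.-1 k) = stepped (stepped (epsD n x) n.-2 k) n.-1 (2 * k).
Proof.
move=> n4; have en : n.-1 = n.-2.+1 by lia.
apply/funext => j; have [->|j1] := eqVneq j n.-1.
  by rewrite /epsD !steppedE /epsD; cases_lia.
have [->|j2] := eqVneq j n.-2; rewrite /epsD !steppedE /epsD -?en; cases_lia.
Qed.

(** The bound on single coordinates says that twice a basis vector is no root of type D;
    [ascendingD_le1] reads it at the nodes before the fork. The last reflection swaps the last two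
    coordinates and changes both signs. *)
Lemma ascendingD_eps n x : (4 <= n)%N -> ascending n (cartan_entry (TypeD n)) x ->
  \sum_(k < n) `|eps (epsD n x) k| <= 2 /\
  forall k, (k < n)%N -> `|eps (epsD n x) k| <= 1.
Proof.
move=> n4; elim=> [{x}i ir|{}x i k xa [IH IH1] ir k0 kE].
  have [ei|ei] := eqVneq i n.-1; last first.
    have e : epsD n (fun j => (j == i)%:Z) = (fun j => (j == i)%:Z).
      by apply/funext => j; rewrite /epsD; cases_lia.
    rewrite e; split; first exact: unit_eps_le2.
    by case=> [|l] _; rewrite /eps; lia.
  have e l : (l < n)%N -> `|eps (epsD n (fun j => (j == i)%:Z)) l| =
      ((l == n.-2) || (l == n.-1))%:Z.
    by case: l => [|l]; rewrite /eps /epsD; cases_lia.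
  split; last by move=> l /e ->; lia.
  rewrite (abs_sum_split _ (i := n.-2)); last by lia.
  rewrite big1 => [|l /andP[l1 l2]]; last by rewrite e //; lia.
  by rewrite !e; lia.
rewrite -/(stepped x i k); have xr := ascending_supp xa.
move: kE; rewrite rowD //; case: ifP => ei kE; last first.
  rewrite epsD_stepped //; last by lia.
  have e0 : eps (stepped (epsD n x) i k) i = eps (epsD n x) i.+1.
    by rewrite stepped_eps0; lia.
  have e1 : eps (stepped (epsD n x) i k) i.+1 = eps (epsD n x) i.
    by rewrite stepped_eps1; lia.
  split.
    rewrite (@abs_sum_swap (eps (epsD n x)) _ _ i) //; first by lia.
      by move=> l; apply: stepped_eps.
    by rewrite e0 e1 addrC.
  move=> l ln; have [->|l0] := eqVneq l i; first by rewrite e0 IH1; lia.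
  have [->|l1] := eqVneq l i.+1; first by rewrite e1 IH1; lia.
  by rewrite stepped_eps // IH1.
have {}ei : i = n.-1 by lia.
rewrite ei epsD_stepped_last //.
have en : n.-1 = n.-2.+1 by lia.
set y := epsD n x in kE IH IH1 *.
have e0 : eps (stepped (stepped y n.-2 k) n.-1 (2 * k)) n.-2 = - eps y n.-1.
  by rewrite stepped_eps ?stepped_eps0; lia.
have e1 : eps (stepped (stepped y n.-2 k) n.-1 (2 * k)) n.-1 = - eps y n.-2.
  by rewrite stepped_eps0 en stepped_eps1 -en; lia.
have eo l : (l < n)%N -> l != n.-2 -> l != n.-1 ->
    eps (stepped (stepped y n.-2 k) n.-1 (2 * k)) l = eps y l.
  by move=> *; rewrite !stepped_eps //; lia.
split.
  apply: le_trans IH; rewrite !(abs_sum_split _ (i := n.-2)); [|lia..].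
  rewrite -en e0 e1 !normrN; apply: lerD; first by rewrite addrC.
  by apply: ler_sum => l /andP[l1 l2]; rewrite eo.
move=> l ln; have [->|l2] := eqVneq l n.-2; first by rewrite e0 normrN IH1; lia.
have [->|l1] := eqVneq l n.-1; first by rewrite e1 normrN IH1; lia.
by rewrite eo // IH1.
Qed.

Lemma eps_partial_sum1 y j n : (j.+1 < n)%N ->
  `|y j| + `|eps y j.+1| <= \sum_(k < n) `|eps y k|.
Proof.
move=> jn; rewrite -(big_mkord xpredT (fun k => `|eps y k|)).
rewrite [leRHS](big_cat_nat (n := j.+2)) //=.
apply: ler_wpDr; first exact: sumr_ge0.
by rewrite big_mkord big_ord_recr lerD2r; apply: eps_partial_sum.
Qed.

Lemma ascendingD_le1 n x i : (4 <= n)%N -> ascending n (cartan_entry (TypeD n)) x ->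
  uncut n (cartan_entry (TypeD n)) x i -> x i <= 1.
Proof.
move=> n4 xa xi; have [V V1] := ascendingD_eps n4 xa; have x0 := ascending_ge0 xa.
have [ni|ni] := leqP n i; first by rewrite (ascending_supp xa).
have yle j : (j < n)%N -> epsD n x j <= 2.
  by move=> jn; apply: le_trans (ler_norm _) (eps_sum_le2 jn V).
have [ei|ei] := eqVneq i n.-1.
  by have := yle i ni; rewrite /epsD ei eqxx; lia.
have [ei2|ei2] := eqVneq i n.-2.
  have en : n.-1 = n.-2.+1 by lia.
  have jn : (n.-2 < n.-1)%N by lia.
  (* These are the absolute values of the sum and the difference of the last two coefficients, so
     together they give twice the larger one. *)
  have : `|epsD n x n.-2| + `|eps (epsD n x) n.-1| <= 2.
    by rewrite {2}en; apply: le_trans (eps_partial_sum1 _ _) V; lia.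
  rewrite {2}en /eps -en ei2 /epsD !eqxx ifF; last by lia.
  by rewrite -en; have := x0 n.-2; have := x0 n.-1; lia.
(* Node [i] separates the nodes before it from those after it. If [x] vanishes before [i], then
   [x i] is coordinate [i]; if it vanishes after [i], then [x i] is minus coordinate [i.+1]. *)
have [|low|high] := xi (fun k => k < i)%N.
- move=> k l kn ln ki il k_i l_i; rewrite /= /laced !D_adjE; split; cases_lia.
- have := V1 i ni; rewrite /eps /epsD; case: i ni ei ei2 low {xi} => [|i] ni ei ei2 low.
    by cases_lia.
  have := low i; have := x0 i.+1.
  by cases_lia.
have := V1 i.+1; have := high i.+1; have := high i.+2; have := x0 i.
by rewrite /eps /epsD; cases_lia.
Qed.

(** * Exceptional types, by enumeration *)

Section Enumeration.
Context (r : nat) (C : nat -> nat -> int) (b : nat).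

Definition pairing_row (i : nat) (v : seq nat) : int :=
  foldr (fun l s => C i l * (nth 0%N v l)%:Z + s) 0 (iota 0 r).

Definition ascents (L : seq (seq nat)) : seq (seq nat) :=
  undup [seq set_nth 0%N v i (nth 0%N v i + `|pairing_row i v|)%N |
         v <- L, i <- [seq i <- iota 0 r | pairing_row i v < 0]].

Definition simple_vectors : seq (seq nat) :=
  [seq [seq (j == i : nat) | j <- iota 0 r] | i <- iota 0 r].

Definition separated (S : seq nat) (i : nat) : bool :=
  all (fun k => all (fun l =>
    [|| k \notin S, l \in S, k == i, l == i | (C k l == 0) && (C l k == 0)])
    (iota 0 r)) (iota 0 r).

(* [v] violates [uncut]: it meets both [S] and the complement of [S] away from [i]. *)
Definition cut_by (i : nat) (v : seq nat) (S : seq nat) : bool :=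
  [&& separated S i,
      has (fun k => [&& k != i, k \in S & nth 0%N v k != 0%N]) (iota 0 r)
    & has (fun k => [&& k != i, k \notin S & nth 0%N v k != 0%N]) (iota 0 r)].

(** The [if] instead of [||] lets call-by-value evaluation look for a cut only when a coefficient is
    too large. *)
Definition bounded_or_cut (cuts : seq (seq nat)) (v : seq nat) : bool :=
  all (fun i => if (nth 0%N v i <= b)%N then true else has (cut_by i v) cuts) (iota 0 r).

(** Success requires an empty level within the fuel, so no root escapes the test. *)
Fixpoint check_ascents (cuts : seq (seq nat)) (fuel : nat) (L : seq (seq nat)) : bool :=
  if L is [::] then true else
  if fuel is n.+1 then all (bounded_or_cut cuts) L && check_ascents cuts n (ascents L)
  else false.

Lemma check_ascentsP cuts fuel L n v : check_ascents cuts fuel L ->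
  v \in iter n ascents L -> bounded_or_cut cuts v.
Proof.
elim: fuel L n => [|f IH] [|w L] n //.
- by move=> _; have -> : iter n ascents [::] = [::] by elim: n => //= n ->.
- by move=> _; have -> : iter n ascents [::] = [::] by elim: n => //= n ->.
case: n => [|n] /andP[/allP ok rest]; first exact: ok.
by rewrite iterSr; apply: IH.
Qed.

Lemma ascending_enum x : ascending r C x ->
  exists n v, v \in iter n ascents simple_vectors /\ x = fun k => (nth 0%N v k)%:Z.
Proof.
elim=> [i ir|{}x i k _ [n [v [vn ->]]] ir k0 kE].
  exists 0%N, [seq (j == i : nat) | j <- iota 0 r]; split.
    by apply/mapP; exists i; rewrite // mem_iota.
  apply/funext => k; have [kr|kr] := ltnP k r.
    by rewrite (nth_map 0%N) ?size_iota // nth_iota.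
  rewrite nth_default ?size_map ?size_iota //; case: eqP => // e; lia.
have dE : pairing_row i v = - k.
  rewrite -kE -(big_mkord xpredT (fun l => C i l * (nth 0%N v l)%:Z)).
  by rewrite /index_iota subn0 unlock.
exists n.+1, (set_nth 0%N v i (nth 0%N v i + `|pairing_row i v|)%N); split.
  rewrite iterS mem_undup; apply/allpairsPdep; exists v, i; split => //.
  by rewrite mem_filter mem_iota dE ir andbT; lia.
apply/funext => l; rewrite nth_set_nth /= dE; case: eqP => [->|_]; lia.
Qed.

Lemma ascending_check cuts fuel x i :
  check_ascents cuts fuel simple_vectors -> ascending r C x -> uncut r C x i ->
  x i <= b%:Z.
Proof.
move=> ok xa xi; have [ri|ir] := leqP r i; first by rewrite (ascending_supp xa).
have [n [v [vn xE]]] := ascending_enum xa.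
have /allP/(_ i) := check_ascentsP ok vn.
rewrite mem_iota => /(_ ir); case: ifP => [vb _|_]; first by rewrite xE.
case/hasP => S _ /and3P[sep /hasP[k _ kP] /hasP[l _ lP]].
have [|H|H] := xi (fun k => k \in S).
- move=> k' l' kr lr kS lS ki li; have /allP/(_ k') := sep.
  rewrite mem_iota => /(_ kr)/allP/(_ l'); rewrite mem_iota => /(_ lr).
  by rewrite kS (negPf lS) (negPf ki) (negPf li) /= => /andP[/eqP -> /eqP ->].
- case/and3P: kP => ki kS; have := H k ki kS.
  by rewrite xE => -[->].
case/and3P: lP => li lS; have := H l li lS.
by rewrite xE => -[->].
Qed.
End Enumeration.

(** The fuel is the Coxeter number h: roots have height at most h - 1 and every ascent raises the
    height, so level h - 1 is empty. Each listed set is a component of the diagram with one interior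
    node removed. *)
Lemma check_exceptional :
  [&& check_ascents 6 (cartan_entry TypeE6) 2 [:: [:: 0; 2]; [:: 1]]%N 12 (simple_vectors 6),
      check_ascents 7 (cartan_entry TypeE7) 2 
        [:: [:: 0]; [:: 0; 2]; [:: 1]; [:: 5; 6]; [:: 6]]%N 18 (simple_vectors 7),
      check_ascents 8 (cartan_entry TypeE8) 3 
        [:: [:: 0]; [:: 0; 2]; [:: 1]; [:: 5; 6; 7]; [:: 6; 7]; [:: 7]]%N 30
        (simple_vectors 8),
      check_ascents 4 (cartan_entry TypeF4) 2 [:: [:: 0]; [:: 3]]%N 12 (simple_vectors 4)
    & check_ascents 2 (cartan_entry TypeG2) 3 [::] 6 (simple_vectors 2)].
Proof. vm_compute. reflexivity. Qed.

Theorem ascending_bound T x i : cartan_type_ok T ->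
  ascending (type_rank T) (cartan_entry T) x ->
  uncut (type_rank T) (cartan_entry T) x i ->
  x i <= (periodicity_bound T)%:Z.
Proof.
have /and5P[e6 e7 e8 f4 g2] := check_exceptional.
case: T => [n|n|n|n|||||] /= ok xa xi; try by
  [apply: (ascending_check e6 xa xi)|apply: (ascending_check e7 xa xi)|
   apply: (ascending_check e8 xa xi)|apply: (ascending_check f4 xa xi)|
   apply: (ascending_check g2 xa xi)].
- exact: ascendingA_le1 xa.
- have [ni|ni] := leqP n i; first by rewrite (ascending_supp xa).
  exact: le_trans (ler_norm _) (eps_sum_le2 ni (ascendingB_eps ok xa)).
- have [ni|ni] := leqP n i; first by rewrite (ascending_supp xa).
  have := le_trans (ler_norm _) (eps_sum_le2 ni (ascendingC_eps ok xa)).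
  by have := ascending_ge0 xa i; rewrite /epsC; case: ifP; lia.
exact: ascendingD_le1 xa xi.
Qed.

(** * Connectivity *)

Section Flags.
Context (K : numFieldType) (g : finLieAlgType K) (I : finType).
Context (X : affine_datum g I) (le : rel (option I)).
Local Notation h := (cartan X).

Lemma SL_delta_uniq : uniq (SL_delta X le).
Proof. by rewrite sort_uniq fset_uniq. Qed.

(** Coefficients are attached to words, so extending them by 0 relies on the words of [SL_delta]
    being distinct. *)
Lemma in_flagW i j (a : dual h) : (i <= j)%N -> in_flag le i a -> in_flag le j a.
Proof.
move=> ij [c cP]; exists (fun v => if v \in take i (SL_delta X le) then c v else 0) => n.
have -> : take j (SL_delta X le) =
    take i (SL_delta X le) ++ drop i (take j (SL_delta X le)).
  by rewrite -{1}(cat_take_drop i (take j (SL_delta X le))) take_takel.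
rewrite big_cat /= [X in _ + X]big1_seq ?addr0.
  by rewrite cP; apply: eq_big_seq => v ->.
move=> v /= vd; rewrite ifF ?scale0r //.
have := take_uniq j SL_delta_uniq.
rewrite -{1}(cat_take_drop i (take j (SL_delta X le))) cat_uniq take_takel //.
by case/and3P => _ /hasPn/(_ v vd)/negbTE.
Qed.

(** The coefficients at t of a flag step, as a subspace of [g] whose dimension can be counted. *)
Definition flag_span i : {vspace g} :=
  <<[seq bracketing X le v 1%N | v <- take i (SL_delta X le)]>>%VS.

Lemma in_flag_span i (a : dual h) : in_flag le i a -> vsval (coroot a) \in flag_span i.
Proof.
move=> [c /(_ 1%N)]; rewrite /monom eqxx => ->; rewrite big_seq.
apply: memv_suml => v vt; rewrite memvZ // memv_span //; apply/mapP.
by exists v.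
Qed.

Lemma dim_flag_span i : (\dim (flag_span i) <= i)%N.
Proof.
apply: leq_trans (dim_span _) _; rewrite size_map size_take_min.
exact: geq_minl.
Qed.

Context (tau : 'Hom(dual h, subvs_of h)).
Hypothesis G : root_geometry tau.
Context (n : nat) (beta : 'I_n -> dual h).
Hypothesis bb : root_base beta.
Hypothesis beta_flag : forall j : 'I_n, in_flag le j.+1 (beta j).

(* The coroots of the first [i] simple roots span the [i]-th step of the flag, by
   comparing dimensions. *)
Lemma in_flag_support i (a : dual h) : (i <= n)%N -> is_root a -> in_flag le i a ->
  exists2 k : 'I_n -> K, a = \sum_j k j *: beta j & forall j : 'I_n, (i <= j)%N -> k j = 0.
Proof.
move=> iN ar ai; have [br bf _] := bb.
pose F j : g := vsval (coroot (beta j)).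
have tauc b : is_root b -> coroot b = (2%:R / b (tau b)) *: tau b by exact: (coroot_tau G).
have nz b : is_root b -> 2%:R / b (tau b) != 0 :> K.
  by move=> ?; rewrite mulf_neq0 ?pnatr_eq0 // invr_eq0 norm_neq0.
have Ffree : free [seq F j | j : 'I_n].
  apply/free_familyP => k k0 j.
  have : \sum_j (k j * (2%:R / beta j (tau (beta j)))) *: beta j = 0.
    apply: (tau_inj G); rewrite linear0; apply: subvs_inj; rewrite linear0 -[RHS]k0.
    rewrite !linear_sum; apply: eq_bigr => l _.
    by rewrite /F tauc // !linearZ /= !scalerA; congr (_ *: _); apply: mulrC.
  move/(free_familyP _).1 : bf => H /H /(_ j)/eqP.
  by rewrite mulf_eq0 (negPf (nz _ _)) ?orbF // => /eqP.
pose s := filter (fun j : 'I_n => (j < i)%N) (enum 'I_n).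
pose Y := [seq F j | j <- s].
have Yfree : free Y.
  apply: (@catl_free _ _ [seq F j | j <- filter (fun j : 'I_n => ~~ (j < i)%N) (enum 'I_n)]).
  by rewrite -map_cat (perm_free (perm_map _ (permEl (perm_filterC _ _)))).
have sY : size Y = i.
  rewrite size_map size_filter.
  have -> : count (fun j : 'I_n => (j < i)%N) (enum 'I_n) = count (fun j => j < i)%N (iota 0 n).
    by rewrite -val_enum_ord count_map.
  rewrite -(subnKC iN) iotaD count_cat add0n.
  rewrite (_ : count _ (iota 0 i) = i); last first.
    rewrite -[RHS](size_iota 0); apply/eqP; rewrite -all_count; apply/allP => j.
    by rewrite mem_iota.
  rewrite (_ : count _ _ = 0%N) ?addn0 //; apply/eqP; rewrite -leqn0 leqNgt -has_count.
  by apply/hasPn => j; rewrite mem_iota -leqNgt => /andP[].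
have YU : (<<Y>> = flag_span i)%VS.
  apply/eqP; rewrite eqEdim; apply/andP; split; last first.
    by rewrite (eqP Yfree) sY dim_flag_span.
  apply/span_subvP => _ /mapP[j js ->]; apply: in_flag_span.
  apply: (in_flagW _ (beta_flag j)).
  by move: js; rewrite mem_filter => /andP[].
have : vsval (coroot a) \in <<Y>>%VS by rewrite YU; apply: in_flag_span.
move=> /(free_span Yfree)[k + _]; rewrite big_map big_filter big_enum_cond /=.
move=> aE.
(* The factors turn coroots back into roots, a coroot being [tau] of its root scaled by 2 over the
   norm. *)
exists (fun j : 'I_n => if (j < i)%N then
    (2%:R / a (tau a))^-1 * (k (F j) * (2%:R / beta j (tau (beta j)))) else 0); last first.
  by move=> j ij; rewrite ltnNge ij.
apply: (tau_inj G); apply: (scalerI (nz a ar)); rewrite -tauc //.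
apply: subvs_inj; rewrite aE !linear_sum [RHS]big_mkcond /= [LHS]big_mkcond.
apply: eq_bigr => j _; case: ifP => ji; last first.
  by rewrite scale0r ?linear0 ?scaler0 ?linear0.
rewrite /F tauc // !linearZ /= !scalerA; congr (_ *: _).
by rewrite [RHS]mulrC mulVKf ?nz // mulrC.
Qed.

(** Signed coefficients cover positive and negative roots together. *)
Definition supported (P : 'I_n -> Prop) (a : dual h) :=
  exists2 c : 'I_n -> int, a = \sum_j beta j *~ c j & forall j, c j <> 0 -> P j.

Lemma supported_orth (P Q : 'I_n -> Prop) (a b : dual h) : is_root b ->
  supported P a -> supported Q b ->
  (forall i j, P i -> Q j -> beta i (coroot (beta j)) = 0 :> K) ->
  a (coroot b) = 0 :> K.
Proof.
move=> br [c aE cP] [d bE dQ] PQ; have [betar _ _] := bb.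
rewrite (pairingE G) // (_ : a (tau b) = 0) ?mulr0 ?mul0r //.
rewrite {1}aE dual_sum big1 // => i _; rewrite dualMz.
have [->|/eqP ci] := eqVneq (c i) 0; first exact: mulr0z.
rewrite (tau_sym G) bE dual_sum big1 ?mul0rz // => j _; rewrite dualMz.
have [->|/eqP dj] := eqVneq (d j) 0; first exact: mulr0z.
have := PQ i j (cP _ ci) (dQ _ dj); rewrite (pairingE G) // => /eqP.
rewrite !mulf_eq0 pnatr_eq0 /= invr_eq0 (negPf (norm_neq0 G (betar j))) orbF.
by rewrite (tau_sym G) => /eqP ->; rewrite mul0rz.
Qed.

Hypothesis beta_irr : forall i : nat, (1 <= i <= n)%N ->
  irreducible_roots [set a : dual h | is_root a /\ in_flag le i a].

(** An orthogonal split of the nodes below [i] would split the roots of the flag step into those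
    supported on either side. Irreducibility empties one side, yet each side contains a simple
    root. *)
Lemma connected_no_cut (i : 'I_n) (S : pred 'I_n) :
  (forall k l : 'I_n, (k < i)%N -> (l < i)%N -> S k -> ~~ S l ->
     beta k (coroot (beta l)) = 0 :> K /\ beta l (coroot (beta k)) = 0 :> K) ->
  (forall k : 'I_n, (k < i)%N -> ~~ S k) \/ (forall k : 'I_n, (k < i)%N -> S k).
Proof.
move=> orth; have [betar _ _] := bb.
apply: contrapT => /not_orP[/existsNP[k /not_implyP[ki /negP/negPn Sk]]].
move=> /existsNP[l /not_implyP[li /negP Sl]].
(* Nodes are numbered from 0, so step [i] of the flag carries exactly the simple roots strictly
   below node [i]. *)
pose D : set (dual h) := [set a : dual h | is_root a /\ in_flag le i a].
pose P (j : 'I_n) := (j < i)%N /\ S j; pose Q (j : 'I_n) := (j < i)%N /\ ~~ S j.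
have [|_ irr] := beta_irr (i := i).
  by rewrite (leq_ltn_trans (leq0n k) ki) /= ltnW // ltn_ord.
have simpleD (j : 'I_n) : (j < i)%N -> D (beta j).
  by move=> ji; split => //; apply: (in_flagW ji).
have supp1 (j : 'I_n) : beta j = \sum_m beta m *~ (m == j)%:Z.
  by rewrite {1}(base_delta beta j); apply: eq_bigr.
have supp1P R (j : 'I_n) : R j -> supported R (beta j).
  by move=> Rj; exists (fun m => (m == j)%:Z) => // m; case: eqP => // ->.
have DPQ : D = (D `&` supported P) `|` (D `&` supported Q).
  apply/seteqP; split => [a [ar ai]|a [[]|[]] //].
  have [c aE c0] := in_flag_support (ltnW (ltn_ord i)) ar ai.
  (* The connected support of a positive root lies on one side of [S]; a negative root is treated
     through its opposite. *)
  have half (b : dual h) (m : 'I_n -> nat) : is_root b -> b = \sum_j beta j *+ m j ->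
      (forall j, (0 < m j)%N -> (j < i)%N) -> supported P b \/ supported Q b.
    move=> br bE mi.
    have bz : b = \sum_j beta j *~ (m j : int) by rewrite bE.
    have cr : is_root (\sum_j beta j *+ m j) by rewrite -bE.
    have [||Sm|Sm] := root_support_connected G bb (p := S) cr.
    - by move=> u v mu mv Su Sv; have [] := orth u v (mi _ mu) (mi _ mv) Su Sv.
    - by move=> u v mu mv Su Sv; have [] := orth u v (mi _ mu) (mi _ mv) Su Sv.
    - left; exists (fun j => m j : int) => // j mj.
      have m0 : (0 < m j)%N by lia.
      by split; [apply: mi|apply: Sm].
    right; exists (fun j => m j : int) => // j mj.
    have m0 : (0 < m j)%N by lia.
      by split; [apply: mi|apply: Sm].
  have coefK (d : 'I_n -> int) : a = \sum_j beta j *~ d j ->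
      forall j, d j <> 0 -> (j < i)%N.
    move=> ad j dj; rewrite ltnNge; apply/negP => ij; apply: dj.
    have [_ /(free_familyP _).1 bf _] := bb.
    have /bf/(_ j)/eqP : \sum_j (c j - (d j)%:~R) *: beta j = 0.
      rewrite -[RHS](subrr a) {1}aE ad -sumrB; apply: eq_bigr => m _.
      by rewrite scalerBl scaler_int.
    by rewrite c0 // sub0r oppr_eq0 intr_eq0 => /eqP.
  have [[m mE]|[m mE]] := base_root_cases bb ar.
    have [|?|?] := half a m ar mE; [|by left|by right].
    by move=> j mj; apply: (coefK (fun j => m j : int)) => //; lia.
  have [|[d dE dP]|[d dE dP]] := half (- a) m (rootN G ar) mE.
  - move=> j mj; apply: (coefK (fun j => - (m j : int))); last by lia.
    rewrite -[LHS]opprK mE -sumrN; apply: eq_bigr => u _.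
    by rewrite mulrNz.
  - left; split=> //; exists (fun j => - d j) => [|j dj]; last by apply: dP; lia.
    by rewrite -[LHS]opprK dE -sumrN; apply: eq_bigr => u _; rewrite mulrNz.
  right; split=> //; exists (fun j => - d j) => [|j dj]; last by apply: dP; lia.
  by rewrite -[LHS]opprK dE -sumrN; apply: eq_bigr => u _; rewrite mulrNz.
have [|A0|B0] := irr _ _ DPQ.
- move=> a b [_ aP] [[br _] bQ]; apply: (supported_orth br aP bQ).
  by move=> u v [ui Su] [vi Sv]; have [] := orth u v ui vi Su Sv.
- have : (D `&` supported P) (beta k) by split; [apply: simpleD|apply: supp1P].
  by rewrite A0.
have : (D `&` supported Q) (beta l).
  by split; [apply: simpleD|apply: supp1P; split => //; apply/negP].
by rewrite B0.
Qed.
End Flags.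

(** * From the Cartan type and connectivity to the bound *)

Lemma cartan_entry_diag T i : cartan_type_ok T -> cartan_entry T i i = 2.
Proof.
case: T => [n|n|n|n|||||] /= ok; rewrite ?laced_diag ?xpair_eqE //.
all: by case: ifP => // /andP[]; lia.
Qed.

Lemma type_rank_gt0 T : cartan_type_ok T -> (0 < type_rank T)%N.
Proof. by case: T => [n|n|n|n|||||] //=; lia. Qed.

Theorem periodicity_le (K : numFieldType) (g : finLieAlgType K)
    (hg : simple_lie g) (I : finType) (X : affine_datum g I)
    (T : cartan_type) (hT : cartan_type_ok T) (hX : has_cartan_type X T)
    (le : rel (option I))
    (beta : 'I_#|I| -> dual (cartan X))
    (hbeta : Delta_p_simple_roots le beta)
    (hconn : connectivity X le)
    (a : aweight X)
    (hinc : increasing_chains le (chain a))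
    (p : nat) (hp : is_periodicity beta (chain a) p) :
  (p <= periodicity_bound T)%N.
Proof.
have [s sb sE] := hX; have [betab Dp bflag] := hbeta.
have [n [i [PrE ni ntop ->]]] := hp.
have [ar _ _] := alphaP X.
have [s' sK s'K] := sb.
(* Any simple root will do: its diagonal Cartan entry 2 shows that its coroot is not the default
   0. *)
pose i0 : I := s' (Ordinal (type_rank_gt0 hT)).
have [tau G] : exists tau : 'Hom(dual (cartan X), subvs_of (cartan X)), root_geometry tau.
  apply: (@root_geometry_exists K g _ hg (cartanP X) (alpha X i0)) => //.
  by rewrite sE cartan_entry_diag.
have [f fb fE] := base_conjugate G (alphaP X) betab.
have gr : is_root (\sum_j beta j *+ n j).
  have : Delta_p le (Pr (chain a)) by exists (chain a).
  by rewrite Dp PrE => -[].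
have bE k l : beta l (coroot (beta k)) = (cartan_entry T (s (f k)) (s (f l)))%:~R :> K.
  by rewrite fE sE.
have sfb : bijective (s \o f) by apply: bij_comp.
have xa := root_ascending G betab sfb bE gr.
(* [x] carries the coefficients [n] over to Bourbaki's numbering along [s \o f]. *)
set x := (fun k => _) in xa.
have xE j : x ((s \o f) j) = n j.
  rewrite /x (bigD1 j) //= eqxx mul1r big1 ?addr0 // => l lj.
  suff -> : (s (f j) == s (f l) :> nat) = false by rewrite mul0r.
  by apply/negbTE; apply: contra lj => /eqP/val_inj/(bij_inj sb)/(bij_inj fb) ->.
have xP k : x k <> 0 -> exists2 j, k = (s \o f) j & n j <> 0%N.
  move=> xk; apply: contrapT => H; apply: xk; rewrite /x big1 // => j _.
  case: eqP => [kj|_]; last by rewrite mul0r.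
  have [->|/eqP nj] := eqVneq (n j) 0%N; first by rewrite mulr0.
  by case: H; exists j.
rewrite -lez_nat -xE; apply: (ascending_bound hT xa) => S Ssep.
(* Maximality of [i] puts every other node of the support below [i], the range governed by
   [connected_no_cut]. *)
have below j : n j <> 0%N -> (s \o f) j != (s \o f) i :> nat -> (j < i)%N.
  move=> nj ji; rewrite ltn_neqAle leqNgt; apply/andP; split; last first.
    by apply/negP => /ntop.
  by apply: contra ji => /eqP/val_inj ->.
have bflag' (j : 'I_#|I|) : in_flag le j.+1 (beta j) by have [] := bflag j.
have neq_sf (k l : 'I_#|I|) : (k < l)%N -> (s \o f) k != (s \o f) l :> nat.
  move=> kl; apply/eqP => /val_inj/(bij_inj sfb) e.
  by rewrite e ltnn in kl.
have [|nS|allS] := connected_no_cut G betab bflag' hconn (i := i) (S := fun j => S ((s \o f) j)).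
- move=> k l ki li Sk Sl; rewrite !bE.
  have [-> ->] // := Ssep _ _ (ltn_ord ((s \o f) k)) (ltn_ord ((s \o f) l)) Sk Sl
    (neq_sf _ _ ki) (neq_sf _ _ li).
- left => k ki Sk; apply: contrapT => /xP[j kE nj].
  by have := nS j (below j nj _); rewrite -kE => /(_ ki); rewrite Sk.
right => k ki Sk; apply: contrapT => /xP[j kE nj].
by move: Sk; rewrite kE allS // below // -kE.
Qed.

Local Open Scope complex_scope.

Theorem corollary6p42 (R : realType) (g : finLieAlgType R[i])
    (hg : simple_lie g) (I : finType) (X : affine_datum g I)
    (T : cartan_type) (hT : cartan_type_ok T) (hX : has_cartan_type X T)
    (le : rel (option I)) (hle : total_order le)
    (beta : 'I_#|I| -> dual (cartan X))
    (hbeta : Delta_p_simple_roots le beta)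
    (hconn : connectivity X le)
    (a : aweight X) (ha : real_pos a)
    (hinc : increasing_chains le (chain a))
    (p : nat) (hp : is_periodicity beta (chain a) p) :
  (p <= periodicity_bound T)%N.
Proof.
exact: (periodicity_le hg hT hX hbeta hconn hinc hp).
Qed.
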